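(* Fix $B\in(0,1)$. (i) There exists $\alpha_{\mathrm{low}}(B)>0$ such that for any $0<\alpha<\alpha_{\mathrm{low}}(B)$, there exists $\overline\alpha_f(\alpha,B)>0$ such that for all $\alpha_f>\overline\alpha_f(\alpha,B)$, $\eta_{\mathrm{TS}}(B,\alpha,\alpha_f)>\eta_{\mathrm{OS}}(B,\alpha,\alpha_f)$. (ii) There exists $\alpha(B)>0$ such that for any $\alpha>\alpha(B)$, there exists $\overline\alpha_f(\alpha,B)>0$ such that for all $\alpha_f>\overline\alpha_f(\alpha,B)$, $\eta_{\mathrm{TS}}(B,\alpha,\alpha_f)>\eta_{\mathrm{OS}}(B,\alpha,\alpha_f)$.
   Context: For $b^{\mathrm L},b^{\mathrm R}\in[0,1]$ and a $2\times2$ matrix $\mathbf C=[c_{xy}]$ with non-negative entries, $G_n$ is the random bipartite graph with $n$ supply and $n$ demand nodes in which, independently over nodes, each supply node is of type 2 (flexible) with probability $b^{\mathrm L}$ and of type 1 (regular) otherwise, each demand node is of type 2 with probability $b^{\mathrm R}$ and of type 1 otherwise, and, conditional on types, a supply node of type $x$ and a demand node of type $y$ are connected independently with probability $c_{xy}/n$ ($n$ large). $M_\star(G_n)$ is the maximum matching size and $\eta(b^{\mathrm L},b^{\mathrm R};\mathbf C)=\lim_{n\to\infty}\mathbb E[M_\star(G_n)]/n$ (the limit exists). For $\alpha,\alpha_f\ge0$ and a flexibility budget $B\in(0,1]$, set $\mathbf C=\begin{bmatrix}2\alpha&\alpha+\alpha_f\\ \alpha+\alpha_f&2\alpha_f\end{bmatrix}$,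 $\eta_{\mathrm{OS}}(B,\alpha,\alpha_f)=\eta(B,0;\mathbf C)$ (one-sided allocation) and $\eta_{\mathrm{TS}}(B,\alpha,\alpha_f)=\eta(B/2,B/2;\mathbf C)$ (two-sided allocation). *)

(* Defs.v *)
(* MathComp finite types and big operators over the Stdlib reals R, which Rstruct
   makes a MathComp real field; the limit operator is Coquelicot's Lim_seq. *)
From mathcomp Require Import all_boot all_order all_algebra.
From mathcomp Require Export Rstruct.
From Stdlib Require Export Rdefinitions.
From Coquelicot Require Rbar Lim_seq.

Set Implicit Arguments.
Unset Strict Implicit.
Unset Printing Implicit Defensive.

Import Order.TTheory GRing.Theory Num.Theory.
Local Open Scope ring_scope.

(* Types 1 (regular) and 2 (flexible) are the indices 0 and 1 of 'I_2. *)
Definition regular : 'I_2 := ord0.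
Definition flexible : 'I_2 := ord_max.

(* A bipartite graph on n supply and n demand nodes is its set of edges
   (supply node, demand node). *)
Definition bigraph (n : nat) := {set 'I_n * 'I_n}.

Definition is_matching (n : nat) (E M : bigraph n) : bool :=
  (M \subset E) &&
  [forall e in M, forall f in M, ((e.1 == f.1) || (e.2 == f.2)) ==> (e == f)].

Definition max_matching (n : nat) (E : bigraph n) : nat :=
  \max_(M : bigraph n | is_matching E M) #|M|.

Definition bernoulli_pmf (p : R) (b : bool) : R := if b then p else 1 - p.

Definition types_pmf (n : nat) (b : R) (t : {ffun 'I_n -> 'I_2}) : R :=
  \prod_(i < n) bernoulli_pmf b (t i == flexible).

(* The truncation at 1 only matters for the finitely many n with c / n > 1. *)
Definition edge_prob (n : nat) (c : R) : R := Num.min 1 (c / n%:R).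

(* Conditional probability of the edge set E given the supply types s and the
   demand types d. *)
Definition edges_pmf (n : nat) (C : 'M[R]_2) (s d : {ffun 'I_n -> 'I_2})
    (E : bigraph n) : R :=
  \prod_(i < n) \prod_(j < n)
    bernoulli_pmf (edge_prob n (C (s i) (d j))) ((i, j) \in E).

Definition expected_max_matching (n : nat) (bL bR : R) (C : 'M[R]_2) : R :=
  \sum_(s : {ffun 'I_n -> 'I_2}) \sum_(d : {ffun 'I_n -> 'I_2})
    \sum_(E : bigraph n)
      types_pmf bL s * types_pmf bR d * edges_pmf C s d E * (max_matching E)%:R.

(* Lim_seq is total: it is the limit whenever the sequence converges, as it does
   here, and the mean of limsup and liminf otherwise.
   It takes values in the extended reals; the sequence lies in [0, 1] for
   bL, bR in [0, 1] and nonnegative C, so the projection real loses nothing. *)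
Definition eta (bL bR : R) (C : 'M[R]_2) : R :=
  Rbar.real (Lim_seq.Lim_seq (fun n => expected_max_matching n bL bR C / n%:R)).

Definition conn_mx (alpha alphaf : R) : 'M[R]_2 :=
  \matrix_(x, y)
    if x == y then (if x == regular then 2 * alpha else 2 * alphaf)
    else alpha + alphaf.

Definition eta_OS (B alpha alphaf : R) : R := eta B 0 (conn_mx alpha alphaf).

Definition eta_TS (B alpha alphaf : R) : R :=
  eta (B / 2) (B / 2) (conn_mx alpha alphaf).

(* Main.v *)
(* In both regimes the one-sided optimum is bounded away from the two-sided one
   by elementary bounds, without computing the limit eta.

   One-sided: a matching has at most (number of flexible supply nodes) + (number
   of edges at regular supply nodes) edges, which gives
   eta_OS <= B + 2 alpha (1 - B); and it misses every isolated regular supply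
   node, a positive fraction of the nodes for fixed alpha.

   Two-sided: for large alpha_f, a union bound shows that any two sets of at
   least n / h nodes, one flexible and one regular on opposite sides, are joined
   by an edge.  Extending a matching F of the regular nodes greedily by
   flexible-regular edges then produces at least
   min (n, |F| + number of flexible nodes) - 2 n / h - 2 edges.  For small alpha,
   F consists of the isolated edges between regular nodes, about
   2 alpha (1 - B/2)^2 n of them, and (1 - B/2)^2 > 1 - B.  For large alpha, F is
   a maximal matching of the regular nodes, which is large enough for the minimum
   to be n, so the whole graph is almost perfectly matched. *)
Require Import Defs.
From mathcomp Require Import all_boot all_order all_algebra.
From mathcomp Require Import ring lra zify.

Set Implicit Arguments.
Unset Strict Implicit.
Unset Printing Implicit Defensive.

Import Order.TTheory GRing.Theory Num.Theory.
Local Open Scope ring_scope.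

(* R binds its arguments to R_scope, where B / 2 would be Rdiv. *)
Arguments types_pmf n b%_ring_scope t.
Arguments edge_prob n c%_ring_scope.
Arguments expected_max_matching n (bL bR)%_ring_scope C.
Arguments eta (bL bR)%_ring_scope C.
Arguments conn_mx (alpha alphaf)%_ring_scope.

(** * Moments of types and edges *)

(** The expectation of [f] when [w] is a probability mass function. That [w] sums to 1 or is
    nonnegative is assumed only in the lemmas that use it, such as [mean_cst] and [ler_mean]. *)
Definition mean (T : finType) (w f : T -> R) : R := \sum_x w x * f x.

Lemma eq_mean (T : finType) (w f g : T -> R) :
  f =1 g -> mean w f = mean w g.
Proof. by move=> fg; apply: eq_bigr => x _; rewrite fg. Qed.

Lemma meanD (T : finType) (w f g : T -> R) :
  mean w (fun x => f x + g x) = mean w f + mean w g.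
Proof. by rewrite -big_split; apply: eq_bigr => x _; rewrite mulrDr. Qed.

Lemma meanZ (T : finType) (w f : T -> R) (a : R) :
  mean w (fun x => a * f x) = a * mean w f.
Proof. by rewrite [RHS]mulr_sumr; apply: eq_bigr => x _; rewrite mulrCA. Qed.

Lemma meanZr (T : finType) (w f : T -> R) (a : R) :
  mean w (fun x => f x * a) = mean w f * a.
Proof. by rewrite mulrC -meanZ; apply: eq_mean => x; rewrite mulrC. Qed.

Lemma meanN (T : finType) (w f : T -> R) :
  mean w (fun x => - f x) = - mean w f.
Proof. by rewrite -mulN1r -meanZ; apply: eq_mean => x; rewrite mulN1r. Qed.

Lemma mean_sum (T I : finType) (w : T -> R) (P : pred I) (f : I -> T -> R) :
  mean w (fun x => \sum_(i | P i) f i x) = \sum_(i | P i) mean w (f i).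
Proof. by rewrite [RHS]exchange_big; apply: eq_bigr => x _; rewrite mulr_sumr. Qed.

Lemma mean_cst (T : finType) (w : T -> R) (a : R) :
  \sum_x w x = 1 -> mean w (fun=> a) = a.
Proof. by move=> w1; rewrite /mean -mulr_suml w1 mul1r. Qed.

Lemma ler_mean (T : finType) (w f g : T -> R) :
  (forall x, 0 <= w x) -> (forall x, f x <= g x) -> mean w f <= mean w g.
Proof. by move=> w0 fg; apply: ler_sum => x _; rewrite ler_wpM2l. Qed.

Lemma mean_ge0 (T : finType) (w f : T -> R) :
  (forall x, 0 <= w x) -> (forall x, 0 <= f x) -> 0 <= mean w f.
Proof. by move=> w0 f0; apply: sumr_ge0 => x _; rewrite mulr_ge0. Qed.

Lemma bernoulli_pmf_ge0 (p : R) (b : bool) :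
  0 <= p <= 1 -> 0 <= bernoulli_pmf p b.
Proof. by case/andP=> p0 p1; case: b; rewrite //= subr_ge0. Qed.

(** Independence of the node types: distributing the product over the sums turns it into a sum over
    all type assignments. Moments involving few nodes follow by taking [g] equal to 1 at the other
    nodes. *)
Lemma mean_types_prod (n : nat) (b : R) (g : 'I_n -> 'I_2 -> R) :
  mean (types_pmf b) (fun t : {ffun 'I_n -> 'I_2} => \prod_i g i (t i)) =
  \prod_i (b * g i flexible + (1 - b) * g i regular).
Proof.
pose F (i : 'I_n) (x : 'I_2) := bernoulli_pmf b (x == flexible) * g i x.
transitivity (\sum_(t : {ffun 'I_n -> 'I_2}) \prod_i F i (t i)).
  by apply: eq_bigr => t _; rewrite -big_split.
rewrite -bigA_distr_bigA; apply: eq_bigr => i _.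
by rewrite big_ord_recl big_ord1 /F /= addrC; congr (_ * g i _ + _); apply: val_inj.
Qed.

Lemma types_pmf_ge0 (n : nat) (b : R) (t : {ffun 'I_n -> 'I_2}) :
  0 <= b <= 1 -> 0 <= types_pmf b t.
Proof. by move=> b01; apply: prodr_ge0 => i _; apply: bernoulli_pmf_ge0. Qed.

Lemma types_pmf_sum1 (n : nat) (b : R) :
  \sum_(t : {ffun 'I_n -> 'I_2}) types_pmf b t = 1.
Proof.
transitivity (mean (types_pmf b)
  (fun t : {ffun 'I_n -> 'I_2} => \prod_(i < n) (fun _ _ => 1 : R) i (t i))).
  by apply: eq_bigr => t _; rewrite big1 ?mulr1.
by rewrite (mean_types_prod b (fun _ _ => 1)) big1 // => i _; rewrite !mulr1 subrKC.
Qed.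

Lemma mean_types1 (n : nat) (b : R) (i : 'I_n) (a : 'I_2 -> R) :
  mean (types_pmf b) (fun t : {ffun 'I_n -> 'I_2} => a (t i)) =
  b * a flexible + (1 - b) * a regular.
Proof.
pose g (l : 'I_n) := if l == i then a else fun=> 1.
rewrite (@eq_mean _ _ _ (fun t : {ffun 'I_n -> 'I_2} => \prod_l g l (t l))).
  rewrite mean_types_prod (bigD1 i) //= /g eqxx big1 ?mulr1 // => l /negPf ->.
  by rewrite !mulr1 subrKC.
by move=> t; rewrite (bigD1 i) //= /g eqxx big1 ?mulr1 // => l /negPf ->.
Qed.

Lemma mean_types2 (n : nat) (b : R) (i j : 'I_n) (a c : 'I_2 -> R) :
  i != j ->
  mean (types_pmf b) (fun t : {ffun 'I_n -> 'I_2} => a (t i) * c (t j)) =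
  (b * a flexible + (1 - b) * a regular) *
  (b * c flexible + (1 - b) * c regular).
Proof.
move=> ij; pose g (l : 'I_n) := if l == i then a else if l == j then c else fun=> 1.
have ji : (j == i) = false by rewrite eq_sym (negPf ij).
rewrite (@eq_mean _ _ _ (fun t : {ffun 'I_n -> 'I_2} => \prod_l g l (t l))).
  rewrite mean_types_prod (bigD1 i) //= (bigD1 j) ?ji //= /g !eqxx ji.
  rewrite big1 ?mulr1 // => l /andP[/negPf -> /negPf ->].
  by rewrite !mulr1 subrKC.
move=> t; rewrite (bigD1 i) //= (bigD1 j) ?ji //= /g !eqxx ji.
by rewrite big1 ?mulr1 // => l /andP[/negPf -> /negPf ->].
Qed.

(** Any assignment with a flexible node has a factor 0 in its weight. This eliminates the demand
    types from the one-sided allocation. *)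
Lemma mean_types_prob0 (n : nat) (f : {ffun 'I_n -> 'I_2} -> R) :
  mean (types_pmf 0) f = f [ffun=> regular].
Proof.
rewrite /mean (bigD1 [ffun=> regular]) //= big1 => [|t tN].
  rewrite addr0 [types_pmf _ _]big1 ?mul1r // => i _.
  by rewrite ffunE /bernoulli_pmf /= subr0.
suff /existsP[i ti] : [exists i, t i == flexible].
  by rewrite /types_pmf (bigD1 i) //= ti /= !mul0r.
apply: contraR tN; rewrite negb_exists => /forallP tN; apply/eqP/ffunP => i.
by rewrite ffunE; case: (t i) (tN i) => [[|[|k]] hk] // _; apply: val_inj.
Qed.

Definition nflex (n : nat) (t : {ffun 'I_n -> 'I_2}) : R :=
  \sum_i (t i == flexible)%:R.

Lemma mean_nflex (n : nat) (b : R) :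
  mean (types_pmf b) (@nflex n) = n%:R * b.
Proof.
rewrite mean_sum (eq_bigr (fun=> b)) ?sumr_const ?card_ord ?mulr_natl // => i _.
by rewrite (@mean_types1 n b i (fun x => (x == flexible)%:R)) /= mulr0 addr0 mulr1.
Qed.

(** In the expanded square the centred indicators of distinct nodes are independent, so only the
    diagonal survives, and each diagonal term is b (1 - b) <= 1. *)
Lemma var_nflex (n : nat) (b : R) :
  0 <= b <= 1 ->
  mean (types_pmf b) (fun t : {ffun 'I_n -> 'I_2} => (nflex t - n%:R * b) ^+ 2) <= n%:R.
Proof.
move=> /andP[b0 b1]; pose a (x : 'I_2) : R := (x == flexible)%:R - b.
rewrite (@eq_mean _ _ _ (fun t : {ffun 'I_n -> 'I_2} =>
  \sum_(i < n) \sum_(j < n) a (t i) * a (t j))); last first.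
  move=> t; have -> : nflex t - n%:R * b = \sum_i a (t i).
    by rewrite sumrB sumr_const card_ord mulr_natl.
  by rewrite expr2 mulr_suml; apply: eq_bigr => i _; rewrite mulr_sumr.
rewrite mean_sum (_ : n%:R = \sum_(i < n) 1); last by rewrite sumr_const card_ord.
apply: ler_sum => i _; rewrite mean_sum (bigD1 i) //= big1 => [|j ji].
  rewrite addr0 (mean_types1 b i (fun x => a x * a x)) /a /=; nra.
rewrite mean_types2 1?eq_sym // /a /=; nra.
Qed.

Lemma edge_prob_itv (n : nat) (c : R) : 0 <= c -> 0 <= edge_prob n c <= 1.
Proof.
by move=> c0; rewrite /edge_prob le_min ge_min lexx ler01 /= divr_ge0.
Qed.

Definition edge_pr (n : nat) (C : 'M[R]_2) (s d : {ffun 'I_n -> 'I_2})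
  (e : 'I_n * 'I_n) : R := edge_prob n (C (s e.1) (d e.2)).

(** Conditional independence of the edges: a product of two-term sums expands into a sum over edge
    sets. The presence or absence of a given set of edges is the case where [g] is an indicator on
    that set and 1 elsewhere. *)
Lemma mean_edges_prod (n : nat) (C : 'M[R]_2) (s d : {ffun 'I_n -> 'I_2})
    (g : 'I_n * 'I_n -> bool -> R) :
  mean (@edges_pmf n C s d) (fun E : bigraph n => \prod_e g e (e \in E)) =
  \prod_e (edge_pr C s d e * g e true + (1 - edge_pr C s d e) * g e false).
Proof.
rewrite bigA_distr; apply: eq_bigr => E _.
rewrite /edges_pmf pair_bigA -big_split /=; apply: eq_bigr => -[i j] _ /=.
by case: ifP.
Qed.

Lemma edges_pmf_ge0 (n : nat) (C : 'M[R]_2) (s d : {ffun 'I_n -> 'I_2})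
    (E : bigraph n) :
  (forall x y, 0 <= C x y) -> 0 <= edges_pmf C s d E.
Proof.
move=> C0; do 2![apply: prodr_ge0 => ? _].
by apply: bernoulli_pmf_ge0; apply: edge_prob_itv.
Qed.

Lemma edges_pmf_sum1 (n : nat) (C : 'M[R]_2) (s d : {ffun 'I_n -> 'I_2}) :
  \sum_(E : bigraph n) edges_pmf C s d E = 1.
Proof.
transitivity (mean (@edges_pmf n C s d)
  (fun E : bigraph n => \prod_e (fun _ _ => 1 : R) e (e \in E))).
  by apply: eq_bigr => E _; rewrite big1 ?mulr1.
by rewrite (mean_edges_prod C s d (fun _ _ => 1)) big1 // => e _; rewrite !mulr1 subrKC.
Qed.

Lemma prod_natr_forall (T : finType) (A P : pred T) :
  \prod_(e in A) (P e)%:R = [forall e in A, P e]%:R :> R.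
Proof.
have [/forall_inP all_P|] := boolP [forall e in A, P e].
  by rewrite big1 // => e /all_P ->.
rewrite negb_forall => /existsP[e]; rewrite negb_imply => /andP[eA /negPf Pe].
by rewrite (bigD1 e) //= Pe mul0r.
Qed.

Lemma mean_edges_sub (n : nat) (C : 'M[R]_2) (s d : {ffun 'I_n -> 'I_2})
    (T : bigraph n) :
  mean (@edges_pmf n C s d) (fun E : bigraph n => (T \subset E)%:R) =
  \prod_(e in T) edge_pr C s d e.
Proof.
pose g (e : 'I_n * 'I_n) (b : bool) : R := if e \in T then b%:R else 1.
rewrite (@eq_mean _ _ _ (fun E : bigraph n => \prod_e g e (e \in E))); last first.
  move=> E; rewrite -big_mkcond prod_natr_forall; congr (nat_of_bool _)%:R.

  by apply/subsetP/forall_inP.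
rewrite mean_edges_prod [RHS]big_mkcond; apply: eq_bigr => e _; rewrite /g.
by case: ifP; rewrite ?mulr1 ?mulr0 ?addr0 ?subrKC.
Qed.

Lemma mean_edges_avoid (n : nat) (C : 'M[R]_2) (s d : {ffun 'I_n -> 'I_2})
    (T : bigraph n) :
  mean (@edges_pmf n C s d) (fun E : bigraph n => [disjoint T & E]%:R) =
  \prod_(e in T) (1 - edge_pr C s d e).
Proof.
pose g (e : 'I_n * 'I_n) (b : bool) : R := if e \in T then (~~ b)%:R else 1.
rewrite (@eq_mean _ _ _ (fun E : bigraph n => \prod_e g e (e \in E))); last first.
  move=> E; rewrite -big_mkcond prod_natr_forall; congr (nat_of_bool _)%:R.
  by rewrite disjoint_subset; apply/subsetP/forall_inP.
rewrite mean_edges_prod [RHS]big_mkcond; apply: eq_bigr => e _; rewrite /g.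
by case: ifP; rewrite ?mulr1 ?mulr0 ?add0r ?subrKC.
Qed.

(** * Matchings *)

(** Turns cardinalities into natural number variables, so that [lia] treats them as atoms. *)
Ltac abstract_cards :=
  repeat match goal with |- context [ card ?X ] => move: (card X) => ? end.

Lemma is_matchingP (n : nat) (E M : bigraph n) :
  reflect (M \subset E /\
           {in M &, forall e f, e.1 = f.1 \/ e.2 = f.2 -> e = f})
          (is_matching E M).
Proof.
apply: (iffP andP) => [[ME /forall_inP MM]|[ME MM]]; split=> //.
  move=> e f eM fM ef; apply/eqP; move/forall_inP: (MM e eM) => /(_ f fM).
  by move/implyP; apply; case: ef => ->; rewrite eqxx ?orbT.
apply/forall_inP => e eM; apply/forall_inP => f fM; apply/implyP => ef.
by apply/eqP/MM => //; case/orP: ef => /eqP; [left|right].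
Qed.

Lemma leq_max_matching (n : nat) (E M : bigraph n) :
  is_matching E M -> (#|M| <= max_matching E)%N.
Proof. by move=> EM; rewrite /max_matching (leq_bigmax_cond M EM). Qed.

Lemma is_matching_sub (n : nat) (E M F : bigraph n) :
  F \subset M -> is_matching E M -> is_matching E F.
Proof.
move=> FM /is_matchingP[ME MM]; apply/is_matchingP.
split; first exact: subset_trans FM ME.
by move=> e f /(subsetP FM) eM /(subsetP FM) fM; apply: MM.
Qed.

Definition supply (n : nat) (M : bigraph n) : {set 'I_n} := [set e.1 | e in M].
Definition demand (n : nat) (M : bigraph n) : {set 'I_n} := [set e.2 | e in M].

Lemma card_supply (n : nat) (E M : bigraph n) :
  is_matching E M -> #|supply M| = #|M|.
Proof.
move=> /is_matchingP[_ MM]; rewrite card_in_imset // => e f eM fM ef.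
by apply: MM => //; left.
Qed.

(** The deterministic property that the union bound provides with high probability, and the one that
    lets a matching be extended greedily. *)
Definition linked (n : nat) (E : bigraph n) (k : nat) (A D : {set 'I_n}) : bool :=
  [forall A' : {set 'I_n}, forall D' : {set 'I_n},
    [&& A' \subset A, D' \subset D, k <= #|A'| & k <= #|D'|]%N ==>
      ~~ [disjoint setX A' D' & E]].

Lemma linkedP (n : nat) (E : bigraph n) (k : nat) (A D A' D' : {set 'I_n}) :
  linked E k A D -> A' \subset A -> D' \subset D ->
  (k <= #|A'|)%N -> (k <= #|D'|)%N ->
  exists a d, [/\ a \in A', d \in D' & (a, d) \in E].
Proof.
move=> /forallP/(_ A')/forallP/(_ D') /implyP lnk sA sD kA kD.
have := lnk; rewrite sA sD kA kD => /(_ isT) /pred0Pn[[a d] /=].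
by rewrite in_setX => /andP[/andP[aA dD] adE]; exists a, d.
Qed.

(** Take [M] of maximum size among the matchings that contain [F] and add only edges of A x D. If
    [k] nodes were uncovered on both sides, [linked] would give an edge between two of them, which
    could be added to [M]. *)
Lemma matching_extend (n : nat) (E F : bigraph n) (k : nat) (A D : {set 'I_n}) :
  is_matching E F -> linked E k A D ->
  exists M, [/\ is_matching E M, F \subset M, M :\: F \subset setX A D &
    (#|A :\: supply M| < k)%N \/ (#|D :\: demand M| < k)%N].
Proof.
move=> EF lnk.
pose P (M : bigraph n) := [&& is_matching E M, F \subset M & M :\: F \subset setX A D].
have PF : P F by rewrite /P EF subxx setDv sub0set.
case: (arg_maxnP (fun M : bigraph n => #|M|) PF) => M /and3P[EM FM MAD] Mmax.
exists M; split=> //; have [|kA] := ltnP #|A :\: supply M| k; first by left.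
right; rewrite ltnNge; apply/negP => kD.
have [a [d [/setDP[aA aM] /setDP[dD dM] adE]]] :=
  linkedP lnk (subsetDl _ _) (subsetDl _ _) kA kD.
have aM' f : f \in M -> f.1 <> a by move=> fM fa; case/imsetP: aM; exists f.
have dM' f : f \in M -> f.2 <> d by move=> fM fd; case/imsetP: dM; exists f.
have adM : (a, d) \notin M by apply/negP => /aM'.
have : P ((a, d) |: M).
  apply/and3P; split; last 2 first.
  - exact: subset_trans FM (subsetUr _ _).
  - apply/subsetP => e /setDP[/setU1P[->|eM] eF]; first by rewrite in_setX aA.
    by apply: (subsetP MAD); rewrite inE eF.
  case/is_matchingP: EM => ME MM; apply/is_matchingP; split.
    by rewrite subUset sub1set adE.
  move=> e f /setU1P[->|eM] /setU1P[->|fM] //=; last exact: MM.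
  - by case=> /esym => [/(aM' _ fM)|/(dM' _ fM)].
  - by case=> [/(aM' _ eM)|/(dM' _ eM)].
by move=> /Mmax; rewrite cardsU1 adM /= add1n ltnn.
Qed.

(** Since [F] avoids [S], a node of [S] covered by [M] is an endpoint of an edge of [M] outside
    [F]. *)
Lemma leq_card_supplyD (n : nat) (M F : bigraph n) (S : {set 'I_n}) :
  supply F \subset ~: S -> (#|S| <= #|S :\: supply M| + #|M :\: F|)%N.
Proof.
move=> SF; rewrite -(cardsID (supply M) S) addnC leq_add2l.
apply: leq_trans (leq_imset_card (fun e => e.1) _); apply: subset_leq_card.
apply/subsetP => i /setIP[iS /imsetP[e eM ie]]; apply/imsetP; exists e => //.
rewrite inE eM andbT; apply/negP => eF.
by have /(subsetP SF) : i \in supply F; [rewrite ie imset_f | rewrite inE iS].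
Qed.

Lemma leq_card_demandD (n : nat) (M F : bigraph n) (S : {set 'I_n}) :
  demand F \subset ~: S -> (#|S| <= #|S :\: demand M| + #|M :\: F|)%N.
Proof.
move=> SF; rewrite -(cardsID (demand M) S) addnC leq_add2l.
apply: leq_trans (leq_imset_card (fun e => e.2) _); apply: subset_leq_card.
apply/subsetP => i /setIP[iS /imsetP[e eM ie]]; apply/imsetP; exists e => //.
rewrite inE eM andbT; apply/negP => eF.
by have /(subsetP SF) : i \in demand F; [rewrite ie imset_f | rewrite inE iS].
Qed.

Lemma supply_subX (n : nat) (F : bigraph n) (A D : {set 'I_n}) :
  F \subset setX A D -> supply F \subset A /\ demand F \subset D.
Proof.
by move=> /subsetP FX; split; apply/subsetP => i /imsetP[[a d] /FX];
  rewrite in_setX => /andP[aA dD] ->.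
Qed.

(** Extend [F] inside A x ~D to [M1], then [M1] inside ~A x D to [M2]. The first stage adds at least
    |A| - k edges: either it nearly exhausts [A], or it nearly exhausts ~D, which by |F| + |A| + |D|
    <= n has at least |F| + |A| nodes. Likewise the second adds at least |D| - k. *)
Lemma max_matching_flexible (n : nat) (E F : bigraph n) (k : nat)
    (A D : {set 'I_n}) :
  is_matching E F -> F \subset setX (~: A) (~: D) ->
  linked E k A (~: D) -> linked E k (~: A) D ->
  (#|F| + #|A| + #|D| <= n)%N ->
  (#|F| + #|A| + #|D| <= max_matching E + k.*2)%N.
Proof.
move=> EF FX lnkA lnkD Fn; have [sF dF] := supply_subX FX.
have [M1 [EM1 FM1 MX1 M1k]] := matching_extend EF lnkA.
have [M2 [EM2 FM2 MX2 M2k]] := matching_extend EM1 lnkD.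
have [sM1 dM1] := supply_subX MX1; have [sM2 dM2] := supply_subX MX2.
have DM1 : demand M1 \subset ~: D.
  apply/subsetP => j /imsetP[e eM1 ->]; have [eF|eF] := boolP (e \in F).
    by apply: (subsetP dF); apply: imset_f.
  by apply: (subsetP dM1); apply: imset_f; rewrite inE eF.
have hA := leq_card_supplyD M1 sF.
have hD := leq_card_demandD M2 DM1.
(* The edges of the first stage have their supply ends in [A], so they cover nothing in ~A. *)
have hA' : (#|~: A| <= #|~: A :\: supply M2| + #|M2 :\: (M1 :\: F)|)%N.
  by apply: leq_card_supplyD; rewrite setCK.
have hD' : (#|~: D| <= #|~: D :\: demand M1| + #|M1 :\: set0|)%N.
  by apply: leq_card_demandD; rewrite /demand imset0 sub0set.
have c1 : #|M1 :\: F| = (#|M1| - #|F|)%N by rewrite cardsDS.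
have c2 : #|M2 :\: M1| = (#|M2| - #|M1|)%N by rewrite cardsDS.
have c3 : #|M2 :\: (M1 :\: F)| = (#|M2| - #|M1 :\: F|)%N.
  by rewrite cardsDS // (subset_trans (subsetDl _ _)).
have := cardsC A; have := cardsC D; rewrite !card_ord.
have := subset_leq_card FM1; have := subset_leq_card FM2.
have := leq_max_matching EM2; move: hA' hD'; rewrite setD0.
move: c1 c2 c3 hA hD Fn M1k M2k; clear; abstract_cards; lia.
Qed.

Lemma exists_subset_card (T : finType) (F : {set T}) (m : nat) :
  (m <= #|F|)%N -> exists2 F' : {set T}, F' \subset F & #|F'| = m.
Proof.
move=> mF; exists [set x in take m (enum F)].
  by apply/subsetP => x; rewrite inE => /mem_take; rewrite mem_enum.
by rewrite cardsE (card_uniqP _) ?take_uniq ?enum_uniq // size_takel // -cardE.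
Qed.

(** If [F] is too large for the previous bound, drop edges of it until the sum of the three sizes is
    [n]. *)
Lemma min_max_matching_flexible (n : nat) (E F : bigraph n) (k : nat)
    (A D : {set 'I_n}) :
  is_matching E F -> F \subset setX (~: A) (~: D) ->
  linked E k A (~: D) -> linked E k (~: A) D -> (#|A| + #|D| <= n)%N ->
  (minn n (#|F| + #|A| + #|D|) <= max_matching E + k.*2)%N.
Proof.
move=> EF FX lnkA lnkD ADn.
have [F' F'F F'm] := exists_subset_card (geq_minl #|F| (n - (#|A| + #|D|))).
have := max_matching_flexible (is_matching_sub F'F EF) (subset_trans F'F FX)
  lnkA lnkD.
rewrite F'm; move: ADn; clear; abstract_cards; lia.
Qed.

(** Extending the empty matching inside ~A x ~D leaves fewer than [l] nodes uncovered on one side.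
    As [l] is at most |A| and |D|, the resulting [F] has |F| + |A| + |D| >= n, so the minimum in the
    previous bound is [n]. *)
Lemma max_matching_linked (n : nat) (E : bigraph n) (k l : nat)
    (A D : {set 'I_n}) :
  linked E k A (~: D) -> linked E k (~: A) D -> linked E l (~: A) (~: D) ->
  (l <= #|A|)%N -> (l <= #|D|)%N -> (#|A| + #|D| <= n)%N ->
  (n <= max_matching E + k.*2)%N.
Proof.
move=> lnkA lnkD lnk lA lD ADn.
have E0 : is_matching E set0.
  by apply/is_matchingP; split=> [|e f]; rewrite ?sub0set ?inE.
have [F [EF _ FX Fl]] := matching_extend E0 lnk.
rewrite setD0 in FX.
have hA : (#|~: A| <= #|~: A :\: supply F| + #|F :\: set0|)%N.
  by apply: leq_card_supplyD; rewrite /supply imset0 sub0set.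
have hD : (#|~: D| <= #|~: D :\: demand F| + #|F :\: set0|)%N.
  by apply: leq_card_demandD; rewrite /demand imset0 sub0set.
have := min_max_matching_flexible EF FX lnkA lnkD ADn.
move: hA hD; rewrite setD0; have := cardsC A; have := cardsC D; rewrite !card_ord.
move: Fl lA lD ADn; clear; abstract_cards; lia.
Qed.

(** * Isolated edges, and upper bounds from covers and isolated nodes *)

Definition adjacent (n : nat) (e f : 'I_n * 'I_n) : bool :=
  (e != f) && ((e.1 == f.1) || (e.2 == f.2)).

(** [F] consists of the edges of [S] adjacent to no other edge of [S]; every discarded edge
    contributes at least 1 to the double sum. *)
Lemma isolated_matching (n : nat) (S : bigraph n) :
  exists2 F, is_matching S F &
    (#|S| <= #|F| + \sum_(e in S) \sum_(f in S | adjacent e f) 1)%N.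
Proof.
pose Q e := [exists f in S, adjacent e f].
exists [set e in S | ~~ Q e].
  apply/is_matchingP; split; first by apply/subsetP => e; rewrite inE => /andP[].
  move=> e f; rewrite !inE => /andP[_ /exists_inPn eS] /andP[fS _] ef.
  apply/eqP/negPn/negP => neq; case/negP: (eS f fS); rewrite /adjacent neq.
  by case: ef => ->; rewrite eqxx ?orbT.
rewrite -(cardsID [set e | Q e] S) addnC leq_add //.
  by apply: subset_leq_card; apply/subsetP => e; rewrite !inE andbC.
rewrite -sum1_card big_mkcond [leqRHS]big_mkcond; apply: leq_sum => e _.
rewrite !inE; case: (e \in S) => //=; case: ifP => // /exists_inP[f fS ef].
by rewrite (bigD1 f) ?fS.
Qed.

(** Matching edges with supply end in [A] have distinct supply ends; the others are counted without
    using that they form a matching. *)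
Lemma max_matching_le_cover (n : nat) (E : bigraph n) (A : {set 'I_n}) :
  (max_matching E <= #|A| + #|E :&: setX (~: A) setT|)%N.
Proof.
apply/bigmax_leqP => M EM; have /is_matchingP[ME _] := EM.
rewrite -(cardsID (setX A setT) M) leq_add //; last first.
  apply: subset_leq_card; apply/subsetP => -[a d].
  by rewrite !(inE, in_setX) !andbT => /andP[aA /(subsetP ME) ->].
rewrite -(card_supply (is_matching_sub (subsetIl _ (setX A setT)) EM)).
apply: subset_leq_card; apply/subsetP => i /imsetP[[a d]].
by rewrite !(inE, in_setX) => /and3P[_ aA _] ->.
Qed.

(** Stated as disjointness from a row of pairs, the form whose probability [mean_edges_avoid]
    computes. *)
Definition no_edge (n : nat) (E : bigraph n) (i : 'I_n) : bool :=
  [disjoint setX [set i] [set: 'I_n] & E].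

Lemma max_matching_isolated (n : nat) (E : bigraph n) (A : {set 'I_n}) :
  {in A, forall i, no_edge E i} -> (max_matching E + #|A| <= n)%N.
Proof.
move=> AE; rewrite -[X in (_ <= X)%N]card_ord -(cardC A) addnC leq_add2l.
apply/bigmax_leqP => M EM; have /is_matchingP[ME _] := EM.
rewrite -(card_supply EM); apply: subset_leq_card; apply/subsetP => i.
case/imsetP=> [[a d] /(subsetP ME) adE ->]; rewrite !inE /=; apply/negP => /AE.
by move/disjointFl => /(_ _ adE); rewrite in_setX !inE eqxx.
Qed.

Lemma max_matching_le (n : nat) (E : bigraph n) : (max_matching E <= n)%N.
Proof.
by have := @max_matching_isolated n E set0; rewrite cards0 addn0; apply=> i; rewrite inE.
Qed.

(** * Union bound and edge counts *)

Lemma bernoulli_ineq (y : R) (n : nat) : 0 <= y -> 1 + n%:R * y <= (1 + y) ^+ n.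
Proof.
move=> y0; elim: n => [|n IH]; first by rewrite mul0r addr0 expr0.
rewrite exprS; apply: le_trans (ler_wpM2l _ IH); last by rewrite addr_ge0.
have : 0 <= n%:R * y * y by rewrite !mulr_ge0.
by rewrite -natr1; lra.
Qed.

(** With y = c / n, Bernoulli gives 1 + c <= (1 + y)^n, and (1 + y)^n (1 - y)^n = (1 - y^2)^n <= 1.
    This replaces an exponential estimate. *)
Lemma expr_one_sub_div_le (c : R) (n : nat) :
  0 <= c <= n%:R -> (1 + c) * (1 - c / n%:R) ^+ n <= 1.
Proof.
case: n => [|n] /andP[c0 cn]; first by rewrite expr0; lra.
set y := c / n.+1%:R; have y0 : 0 <= y by rewrite divr_ge0.
have y1 : y <= 1 by rewrite ler_pdivrMr ?mul1r.
have -> : c = n.+1%:R * y by rewrite mulrC divfK ?pnatr_eq0.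
have q0 : 0 <= (1 - y) ^+ n.+1 by rewrite exprn_ge0 // subr_ge0.
apply: le_trans (ler_wpM2r q0 (bernoulli_ineq n.+1 y0)) _.
by rewrite -exprMn exprn_ile1 //; nra.
Qed.

(* Raising both sides to the power h ^ 2 reduces the claim to
   (1 - c / n) ^ (n * n) <= (1 + c) ^ - n. *)
Lemma expr_one_sub_div_le8 (c : R) (n k h : nat) :
  0 <= c <= n%:R -> (0 < h)%N -> (n <= k * h)%N -> 8 ^+ (h * h) <= 1 + c ->
  8 ^+ n * (1 - c / n%:R) ^+ (k * k) <= 1.
Proof.
move=> /andP[c0 cn] h0 nkh hc; set q := 1 - c / n%:R.
have q0 : 0 <= q.
  rewrite subr_ge0; case: n cn {nkh q} => [|n] cn; first by rewrite invr0 mulr0.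
  by rewrite ler_pdivrMr ?mul1r.
have q1 : q <= 1 by rewrite gerBl divr_ge0.
have H : 8 ^+ n * q ^+ (k * k) >= 0 by rewrite mulr_ge0 ?exprn_ge0.
rewrite -(@expr_le1 _ (h * h)) ?muln_gt0 ?h0 //.
rewrite exprMn -!exprM mulnC [(8 ^+ _)]exprM mulnACA.
apply: (@le_trans _ _ ((1 + c) ^+ n * q ^+ (n * n))).
  apply: ler_pM; rewrite ?exprn_ge0 //.
    by apply: lerXn2r; rewrite ?nnegrE ?exprn_ge0 // addr_ge0.
  by apply: ler_wiXn2l => //; rewrite leq_mul.
rewrite exprM -exprMn exprn_ile1 //; first by rewrite mulr_ge0 ?exprn_ge0 // addr_ge0.
by apply: expr_one_sub_div_le; rewrite c0.
Qed.

Lemma edge_probE (n : nat) (c : R) :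
  0 <= c <= n%:R -> edge_prob n c = c / n%:R.
Proof.
case: n => [|n] /andP[c0 cn]; rewrite /edge_prob.
  by rewrite invr0 mulr0; apply/min_idPr.
by apply/min_idPr; rewrite ler_pdivrMr ?mul1r.
Qed.

(** Union bound over at most 2^n * 2^n pairs of subsets: each pair of size at least k x k carries no
    edge with probability at most (1 - c/n)^(k^2) <= 8^-n, and 4/8 = 1/2. *)
Lemma mean_unlinked (n : nat) (C : 'M[R]_2) (s d : {ffun 'I_n -> 'I_2})
    (A D : {set 'I_n}) (x y : 'I_2) (k h : nat) :
  (forall x y, 0 <= C x y) ->
  {in A, forall i, s i = x} -> {in D, forall j, d j = y} ->
  C x y <= n%:R -> (0 < h)%N -> (n <= k * h)%N -> 8 ^+ (h * h) <= 1 + C x y ->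
  mean (@edges_pmf n C s d) (fun E => (~~ linked E k A D)%:R) <= 2^-1 ^+ n.
Proof.
move=> C0 sA dD cn h0 nkh hc.
pose P (A' D' : {set 'I_n}) := [&& A' \subset A, D' \subset D, k <= #|A'| & k <= #|D'|]%N.
have cn' : 0 <= C x y <= n%:R by rewrite C0.
have q0 : 0 <= 1 - C x y / n%:R.
  rewrite subr_ge0; case: (n) cn => [|m] cm; first by rewrite invr0 mulr0.
  by rewrite ler_pdivrMr ?mul1r.
pose G (E : bigraph n) : R := \sum_(A' : {set 'I_n}) \sum_(D' | P A' D')
  [disjoint setX A' D' & E]%:R.
apply: (@le_trans _ _ (mean (@edges_pmf n C s d) G)).
  apply: ler_mean => [E|E]; first exact: edges_pmf_ge0.
  have G0 : 0 <= G E by do 2![apply: sumr_ge0 => ? _].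
  have [//|] := boolP (linked E k A D).
  rewrite negb_forall => /existsP[A']; rewrite negb_forall => /existsP[D'].
  rewrite negb_imply negbK => /andP[PAD AD].
  rewrite /G (bigD1 A') //= (bigD1 D') //= AD.
  by rewrite -addrA lerDl addr_ge0 //; do ?[apply: sumr_ge0 => ? _].
rewrite mean_sum; under eq_bigr do rewrite mean_sum.
apply: (@le_trans _ _ (\sum_(A' : {set 'I_n}) \sum_(D' : {set 'I_n}) 8^-1 ^+ n)).
  apply: ler_sum => A' _; rewrite big_mkcond; apply: ler_sum => D' _.
  case: ifP => [/and4P[AA DD kA kD]|]; last by rewrite exprn_ge0 ?invr_ge0.
  rewrite mean_edges_avoid (eq_bigr (fun=> 1 - C x y / n%:R)); last first.
    move=> [i j]; rewrite in_setX => /andP[iA jD].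
    by rewrite /edge_pr /= (sA _ (subsetP AA _ iA)) (dD _ (subsetP DD _ jD)) edge_probE.
  rewrite prodr_const cardsX exprVn -[X in _ <= X]mul1r ler_pdivlMr ?exprn_gt0 //.
  apply: le_trans (expr_one_sub_div_le8 cn' h0 nkh hc); rewrite mulrC ler_wpM2l ?exprn_ge0 //.
  by apply: ler_wiXn2l; rewrite ?leq_mul // gerBl divr_ge0.
rewrite !sumr_const -cardsT -powersetT card_powerset cardsT card_ord.
rewrite -mulrnA -[X in X <= _]mulr_natl natrM natrX -!exprMn.
by rewrite (_ : 2 * 2 * 8^-1 = 2^-1) //; lra.
Qed.

Lemma mean_edge1 (n : nat) (C : 'M[R]_2) (s d : {ffun 'I_n -> 'I_2})
    (e : 'I_n * 'I_n) :
  mean (@edges_pmf n C s d) (fun E => (e \in E)%:R) = edge_pr C s d e.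
Proof.
have <- : \prod_(l in [set e]) edge_pr C s d l = edge_pr C s d e by rewrite big_set1.
rewrite -mean_edges_sub.
by apply: eq_mean => E; rewrite sub1set.
Qed.

Lemma mean_edge2 (n : nat) (C : 'M[R]_2) (s d : {ffun 'I_n -> 'I_2})
    (e f : 'I_n * 'I_n) :
  e != f ->
  mean (@edges_pmf n C s d) (fun E => (e \in E)%:R * (f \in E)%:R) =
  edge_pr C s d e * edge_pr C s d f.
Proof.
move=> ef.
have <- : \prod_(l in [set e; f]) edge_pr C s d l = edge_pr C s d e * edge_pr C s d f.
  by rewrite big_setU1 ?inE // big_set1.
rewrite -mean_edges_sub; apply: eq_mean => E.
by rewrite subUset !sub1set; do 2!case: (_ \in E); rewrite ?mulr0 ?mul0r ?mulr1.
Qed.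

(** * Flexible and regular nodes, and moments of the edges between regular nodes *)

Definition flex (n : nat) (t : {ffun 'I_n -> 'I_2}) : {set 'I_n} :=
  [set i | t i == flexible].

Lemma card_flex (n : nat) (t : {ffun 'I_n -> 'I_2}) : #|flex t|%:R = nflex t.
Proof.
rewrite /nflex -sum1_card natr_sum [LHS]big_mkcond; apply: eq_bigr => i _.
by rewrite inE; case: (_ == _).
Qed.

Lemma card_regular (n : nat) (t : {ffun 'I_n -> 'I_2}) :
  #|~: flex t|%:R = n%:R - nflex t :> R.
Proof.
by rewrite cardsCs setCK card_ord natrB ?card_flex // -[leqRHS]card_ord max_card.
Qed.

Lemma not_flex (n : nat) (t : {ffun 'I_n -> 'I_2}) (i : 'I_n) :
  i \in ~: flex t -> t i = regular.
Proof.
by rewrite !inE; case: (t i) => [[|[|m]] hm] // _; apply: val_inj.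
Qed.

Lemma natr_cardI (T : finType) (A B : {set T}) :
  #|A :&: B|%:R = \sum_(i in A) (i \in B)%:R :> R.
Proof.
rewrite -sum1_card natr_sum big_mkcond [RHS]big_mkcond; apply: eq_bigr => i _.
by rewrite inE; do 2!case: (_ \in _).
Qed.

Definition regular_pairs (n : nat) (s d : {ffun 'I_n -> 'I_2}) : bigraph n :=
  setX (~: flex s) (~: flex d).

Lemma edge_pr_regular (n : nat) (C : 'M[R]_2) (s d : {ffun 'I_n -> 'I_2})
    (e : 'I_n * 'I_n) :
  e \in regular_pairs s d -> edge_pr C s d e = edge_prob n (C regular regular).
Proof.
by case: e => i j; rewrite in_setX /edge_pr /= => /andP[/not_flex -> /not_flex ->].
Qed.

Definition nregular_edges (n : nat) (s d : {ffun 'I_n -> 'I_2}) (E : bigraph n) : R :=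
  \sum_(e in regular_pairs s d) (e \in E)%:R.

Lemma mean_nregular_edges (n : nat) (C : 'M[R]_2) (s d : {ffun 'I_n -> 'I_2}) :
  mean (@edges_pmf n C s d) (nregular_edges s d) =
  (n%:R - nflex s) * (n%:R - nflex d) * edge_prob n (C regular regular).
Proof.
rewrite mean_sum (eq_bigr (fun=> edge_prob n (C regular regular))); last first.
  by move=> e eX; rewrite mean_edge1 edge_pr_regular.
by rewrite sumr_const cardsX -[LHS]mulr_natl natrM !card_regular.
Qed.

Lemma leq_card_bigraph (n : nat) (E : bigraph n) : (#|E| <= n * n)%N.
Proof. by rewrite -[leqRHS](_ : #|[set: 'I_n * 'I_n]| = _) ?subset_leq_card // cardsT card_prod card_ord. Qed.

(** Each of the at most n^2 diagonal terms has mean p, and each of the at most n^4 off-diagonal ones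
    has mean p^2. *)
Lemma mean_nregular_edges_sqr (n : nat) (C : 'M[R]_2) (s d : {ffun 'I_n -> 'I_2}) :
  (forall x y, 0 <= C x y) ->
  mean (@edges_pmf n C s d) (fun E => nregular_edges s d E ^+ 2) <=
  n%:R ^+ 2 * edge_prob n (C regular regular) +
  n%:R ^+ 4 * edge_prob n (C regular regular) ^+ 2.
Proof.
move=> C0; set p := edge_prob _ _; have /andP[p0 p1] := edge_prob_itv n (C0 regular regular).
rewrite (@eq_mean _ _ (fun E => _ ^+ 2) (fun E : bigraph n => \sum_(e in regular_pairs s d)
    \sum_(f in regular_pairs s d) (e \in E)%:R * (f \in E)%:R)); last first.
  by move=> E; rewrite expr2 mulr_suml; apply: eq_bigr => e _; rewrite mulr_sumr.
rewrite mean_sum.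
apply: (@le_trans _ _ (\sum_(e in regular_pairs s d) (p + n%:R ^+ 2 * p ^+ 2))).
  apply: ler_sum => e eX; rewrite mean_sum (bigD1 e) //=; apply: lerD.
    rewrite (@eq_mean _ _ _ (fun E : bigraph n => (e \in E)%:R)).
      by rewrite mean_edge1 edge_pr_regular.
    by move=> E; case: (_ \in E); rewrite ?mulr1 ?mulr0.
  rewrite (eq_bigr (fun=> p ^+ 2)); last first.
    by move=> f /andP[fX fe]; rewrite mean_edge2 1?eq_sym // !edge_pr_regular.
  apply: (@le_trans _ _ (\sum_(f in regular_pairs s d) p ^+ 2)).
    rewrite [leRHS]big_mkcond [leLHS]big_mkcond; apply: ler_sum => f _ /=.
    by case: (f \in _); case: (f != e) => //=; rewrite exprn_ge0.
  by rewrite sumr_const -[leLHS]mulr_natl ler_wpM2r ?exprn_ge0 // -natrX ler_nat leq_card_bigraph.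
rewrite sumr_const -[leLHS]mulr_natl [leRHS](_ : _ = n%:R ^+ 2 * (p + n%:R ^+ 2 * p ^+ 2)); last by ring.
by rewrite ler_wpM2r ?addr_ge0 ?mulr_ge0 ?exprn_ge0 // -natrX ler_nat leq_card_bigraph.
Qed.

Definition nadjacent (n : nat) (s d : {ffun 'I_n -> 'I_2}) (E : bigraph n) : R :=
  \sum_(e in regular_pairs s d) \sum_(f in regular_pairs s d | adjacent e f)
    (e \in E)%:R * (f \in E)%:R.

(** A pair is adjacent to at most 2 n others, those in its row or column, and two distinct edges are
    both present with probability p^2. *)
Lemma mean_nadjacent (n : nat) (C : 'M[R]_2) (s d : {ffun 'I_n -> 'I_2}) :
  (forall x y, 0 <= C x y) ->
  mean (@edges_pmf n C s d) (nadjacent s d) <=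
  2 * n%:R ^+ 3 * edge_prob n (C regular regular) ^+ 2.
Proof.
move=> C0; set p := edge_prob _ _.
have /andP[p0 p1] := edge_prob_itv n (C0 regular regular).
rewrite mean_sum.
apply: (@le_trans _ _ (\sum_(e in regular_pairs s d) 2 * n%:R * p ^+ 2)); last first.
  rewrite sumr_const -[leLHS]mulr_natl [leRHS](_ : _ = n%:R ^+ 2 * (2 * n%:R * p ^+ 2)); last by ring.
  by rewrite ler_wpM2r ?mulr_ge0 ?exprn_ge0 // -natrX ler_nat leq_card_bigraph.
apply: ler_sum => e eX; rewrite mean_sum (eq_bigr (fun=> p ^+ 2)); last first.
  by move=> f /and3P[fX ef _]; rewrite mean_edge2 // !edge_pr_regular.
rewrite sumr_const -[X in X <= _]mulr_natl ler_wpM2r ?exprn_ge0 // -natrM ler_nat.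
apply: (@leq_trans #|setX [set e.1] [set: 'I_n] :|: setX [set: 'I_n] [set e.2]|).
  apply: subset_leq_card; apply/subsetP => -[i j].
  case/andP=> _ /andP[_ /=].
  by rewrite !(inE, in_setX) /= andbT (eq_sym i) (eq_sym j).
apply: leq_trans (leq_card_setU _ _) _.
by rewrite !cardsX !cards1 cardsT card_ord muln1 mul1n addnn -mul2n.
Qed.

(** * Bounds on the maximum matching *)

Lemma expected_max_matchingE (n : nat) (bL bR : R) (C : 'M[R]_2) :
  expected_max_matching n bL bR C =
  mean (types_pmf bL) (fun s => mean (types_pmf bR) (fun d =>
    mean (@edges_pmf n C s d) (fun E => (max_matching E)%:R))).
Proof.
apply: eq_bigr => s _; rewrite mulr_sumr; apply: eq_bigr => d _.
by rewrite mulrA mulr_sumr; apply: eq_bigr => E _; rewrite !mulrA.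
Qed.

Lemma regular_edges_card (n : nat) (s d : {ffun 'I_n -> 'I_2}) (E : bigraph n) :
  nregular_edges s d E = #|regular_pairs s d :&: E|%:R.
Proof. by rewrite natr_cardI. Qed.

Lemma isolated_regular_matching (n : nat) (s d : {ffun 'I_n -> 'I_2})
    (E : bigraph n) :
  exists F, [/\ is_matching E F, F \subset regular_pairs s d &
    #|F|%:R <= nregular_edges s d E <= #|F|%:R + nadjacent s d E].
Proof.
have [F SF cF] := isolated_matching (regular_pairs s d :&: E).
have /is_matchingP[FS FF] := SF; exists F; split.
- by apply/is_matchingP; split=> //; apply: subset_trans FS (subsetIr _ _).
- exact: subset_trans FS (subsetIl _ _).
rewrite regular_edges_card ler_nat subset_leq_card //=.
apply: (le_trans (y := (#|F| + \sum_(e in regular_pairs s d :&: E)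
    \sum_(f in regular_pairs s d :&: E | adjacent e f) 1)%:R)); first by rewrite ler_nat.
rewrite natrD lerD2l natr_sum /nadjacent [leLHS]big_mkcond [leRHS]big_mkcond.
apply: ler_sum => e _; rewrite inE; case: (e \in regular_pairs s d) => //=.
case: (e \in E) => /=; last by apply: sumr_ge0 => f _; rewrite mul0r.
rewrite natr_sum [leLHS]big_mkcond [leRHS]big_mkcond.
apply: ler_sum => f _; rewrite inE mul1r.
by case: (f \in regular_pairs s d) => //=; case: (f \in E) => /=; case: adjacent.
Qed.

(** Equivalent to (z - 2 w)^2 >= 0. It bounds an excess over a threshold by a square, whose mean is
    available. *)
Lemma ler_sub_sqr (z w : R) : 0 < w -> z - w <= z ^+ 2 / (4 * w).
Proof.
by move=> w0; rewrite ler_pdivlMr ?mulr_gt0 //; have := sqr_ge0 (z - 2 * w); nra.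
Qed.

Definition unlinked (n : nat) (E : bigraph n) (k : nat) (A D : {set 'I_n}) : R :=
  (~~ linked E k A D)%:R.

Lemma unlinked_ge0 (n : nat) (E : bigraph n) (k : nat) (A D : {set 'I_n}) :
  0 <= unlinked E k A D.
Proof. by rewrite /unlinked; case: linked. Qed.

(* The two squares bound the excess over n of the number of regular edges plus
   flexible nodes; as 1 - B = 2 c, each of the two counts may exceed its mean
   (resp. 0) by c n before the sum exceeds n. *)
Lemma max_matching_ge_isolated (n : nat) (s d : {ffun 'I_n -> 'I_2})
    (E : bigraph n) (k : nat) (B c : R) :
  (0 < n)%N -> 0 < c -> 1 - B = 2 * c ->
  nregular_edges s d E - nadjacent s d E + (nflex s + nflex d)
  - (4 * (c * n%:R))^-1 * nregular_edges s d E ^+ 2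
  - ((4 * (c * n%:R))^-1 + (4 * c ^+ 2 * n%:R)^-1) * (nflex s + nflex d - B * n%:R) ^+ 2
  - k.*2%:R
  - n%:R * (unlinked E k (flex s) (~: flex d) + unlinked E k (~: flex s) (flex d))
  <= (max_matching E)%:R.
Proof.
move=> n0 c0 Bc; have N0 : 0 < n%:R :> R by rewrite ltr0n.
have cN : 0 < c * n%:R by rewrite mulr_gt0.
have [F [EF FX /andP[FS SFP]]] := isolated_regular_matching s d E.
set S := nregular_edges s d E in FS SFP *; set P := nadjacent s d E in SFP *.
set a := nflex s + nflex d; set f : R := #|F|%:R in FS SFP.
have f0 : 0 <= f by rewrite ler0n.
set z := a - B * n%:R.
have hz := ler_sub_sqr z cN; have hf := ler_sub_sqr f cN.
set u1 := unlinked E k _ _; set u2 := unlinked E k _ _.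
have u10 : 0 <= u1 := unlinked_ge0 _ _ _ _.
have u20 : 0 <= u2 := unlinked_ge0 _ _ _ _.
pose i1 := (4 * (c * n%:R))^-1; pose i2 := (4 * c ^+ 2 * n%:R)^-1.
have i10 : 0 <= i1 by rewrite invr_ge0 mulr_ge0 // ltW.
have i20 : 0 <= i2 by rewrite invr_ge0 ?mulr_ge0 ?exprn_ge0 // ltW.
have z2 : 0 <= z ^+ 2 := sqr_ge0 z.
have S2 : f ^+ 2 <= S ^+ 2 by apply: lerXn2r; rewrite ?nnegrE //; apply: le_trans FS.
have S20 : 0 <= S ^+ 2 := sqr_ge0 S.
rewrite -/i1 in hz hf; rewrite -/i1 -/i2.
have hfS : f - c * n%:R <= i1 * S ^+ 2.
  by apply: le_trans hf _; rewrite [leLHS]mulrC ler_wpM2l.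
have hz' : z - c * n%:R <= i1 * z ^+ 2 by rewrite [i1 * _]mulrC.
have p1 : 0 <= i1 * S ^+ 2 by rewrite mulr_ge0.
have p2 : 0 <= i1 * z ^+ 2 by rewrite mulr_ge0.
have p3 : 0 <= i2 * z ^+ 2 by rewrite mulr_ge0.
have k0 : 0 <= k.*2%:R :> R by rewrite ler0n.
have M0 : 0 <= (max_matching E)%:R :> R by rewrite ler0n.
have nu1 : 0 <= n%:R * u1 by rewrite mulr_ge0.
have nu2 : 0 <= n%:R * u2 by rewrite mulr_ge0.
(* After subtracting the squares, [f] and [z] are each at most c n, and a = z + B n with B + 2 c =
   1. *)
have Yn : f + a - i1 * S ^+ 2 - i1 * z ^+ 2 <= n%:R.
  have : a = z + B * n%:R by rewrite /z subrK.
  have : B = 1 - 2 * c by lra.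
  move=> -> ->; move: hfS hz'; rewrite mulrBl mul1r -mulrA; lra.
(* If linking fails, the term n * u equals n and [Yn] makes the left-hand side nonpositive. *)
have [lnk1|] := boolP (linked E k (flex s) (~: flex d)); last first.
  move=> /(congr1 (fun b : bool => b%:R : R)); rewrite -/(unlinked _ _ _ _) -/u1 => u1E.
  by rewrite u1E /= in nu1 *; rewrite !mulrDr mulr1 mulrDl; lra.
have [lnk2|] := boolP (linked E k (~: flex s) (flex d)); last first.
  move=> /(congr1 (fun b : bool => b%:R : R)); rewrite -/(unlinked _ _ _ _) -/u2 => u2E.
  by rewrite u2E /= in nu2 *; rewrite !mulrDr mulr1 mulrDl; lra.
have [ADn|nAD] := leqP (#|flex s| + #|flex d|) n.
  have := min_max_matching_flexible EF FX lnk1 lnk2 ADn.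
  rewrite -(ler_nat R) natrD /minn; case: ifP => _.
    by rewrite !mulrDr mulrDl; lra.
  by rewrite !natrD !card_flex -/f -/a !mulrDr mulrDl /a; lra.
(* With more than n flexible nodes, z is at least (1 - B) n = 2 c n, so the [i2] square alone is at
   least n. *)
have : 2 * (c * n%:R) <= z.
  move: nAD; rewrite -(ltr_nat R) natrD !card_flex -/a => nAD.
  by rewrite /z mulrA -Bc; lra.
move=> zc; have : n%:R <= i2 * z ^+ 2.
  rewrite [leRHS]mulrC ler_pdivlMr ?mulr_gt0 ?exprn_gt0 //.
  rewrite [leLHS](_ : _ = (2 * (c * n%:R)) ^+ 2); last by ring.
  by apply: lerXn2r; rewrite ?nnegrE //; lra.
by rewrite !mulrDr mulrDl; lra.
Qed.

(** A pathwise Chebyshev bound: a failed link, fewer than [l] flexible nodes on one side, or more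
    than [n] flexible nodes in all each make some subtracted term at least [n], so the left-hand
    side is nonpositive. Otherwise [max_matching_linked] applies. *)
Lemma max_matching_ge_linked (n : nat) (s d : {ffun 'I_n -> 'I_2})
    (E : bigraph n) (k l : nat) (B : R) :
  (0 < n)%N -> 0 < B -> B < 1 -> l%:R <= n%:R * B / 4 ->
  n%:R - k.*2%:R
  - n%:R * (unlinked E k (flex s) (~: flex d) + unlinked E k (~: flex s) (flex d)
            + unlinked E l (~: flex s) (~: flex d))
  - (16 / B ^+ 2 + 2 / (1 - B) ^+ 2) / n%:R *
    ((nflex s - n%:R * (B / 2)) ^+ 2 + (nflex d - n%:R * (B / 2)) ^+ 2)
  <= (max_matching E)%:R.
Proof.
move=> n0 B0 B1 lB; have N0 : 0 < n%:R :> R by rewrite ltr0n.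
set u1 := unlinked E k _ _; set u2 := unlinked E k _ _; set u3 := unlinked E l _ _.
have u10 : 0 <= n%:R * u1 by rewrite mulr_ge0 // unlinked_ge0.
have u20 : 0 <= n%:R * u2 by rewrite mulr_ge0 // unlinked_ge0.
have u30 : 0 <= n%:R * u3 by rewrite mulr_ge0 // unlinked_ge0.
set x := nflex s - _; set y := nflex d - _.
set V := x ^+ 2 + y ^+ 2.
have x20 : 0 <= x ^+ 2 := sqr_ge0 x.
have y20 : 0 <= y ^+ 2 := sqr_ge0 y.
have V0 : 0 <= V by rewrite addr_ge0.
pose t1 := 16 / B ^+ 2 / n%:R * V; pose t2 := 2 / (1 - B) ^+ 2 / n%:R * V.
have B20 : 0 < B ^+ 2 by rewrite exprn_gt0.
have B21 : 0 < (1 - B) ^+ 2 by rewrite exprn_gt0 // subr_gt0.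
have t10 : 0 <= t1 by rewrite !mulr_ge0 ?invr_ge0 // ltW.
have t20 : 0 <= t2 by rewrite !mulr_ge0 ?invr_ge0 // ltW.
rewrite [X in _ - X <= _](_ : _ = t1 + t2); last by rewrite /t1 /t2 -mulrDl -mulrDl.
have k0 : 0 <= k.*2%:R :> R by rewrite ler0n.
have M0 : 0 <= (max_matching E)%:R :> R by rewrite ler0n.
have BN0 : 0 < B ^+ 2 * n%:R by rewrite mulr_gt0.
have BN1 : 0 < (1 - B) ^+ 2 * n%:R by rewrite mulr_gt0.
have B'0 : 0 < 1 - B by rewrite subr_gt0.
(* Fewer than [l] flexible nodes, with l <= n B / 4, is a deviation of at least n B / 4 below the
   mean n B / 2. *)
have far w : w <= - (n%:R * B / 4) -> w ^+ 2 <= V -> n%:R <= t1.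
  move=> wB wV; have -> : t1 = 16 * V / (B ^+ 2 * n%:R).
    by rewrite /t1; field; rewrite !lt0r_neq0.
  rewrite ler_pdivlMr //.
  have -> : n%:R * (B ^+ 2 * n%:R) = 16 * (n%:R * B / 4) ^+ 2 by field.
  rewrite ler_wpM2l //; apply: le_trans wV.
  rewrite -[leRHS]sqrrN; apply: lerXn2r; rewrite ?nnegrE; last by lra.
    by rewrite !mulr_ge0 ?invr_ge0 // ltW.
  by have : 0 <= n%:R * B / 4; [rewrite !mulr_ge0 ?invr_ge0 // ltW | lra].
rewrite !mulrDr.
have [lnk1|] := boolP (linked E k (flex s) (~: flex d)); last first.
  move=> /(congr1 (fun b : bool => b%:R : R)); rewrite -/(unlinked _ _ _ _) -/u1 => u1E.
  by rewrite u1E /= in u10 *; lra.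
have [lnk2|] := boolP (linked E k (~: flex s) (flex d)); last first.
  move=> /(congr1 (fun b : bool => b%:R : R)); rewrite -/(unlinked _ _ _ _) -/u2 => u2E.
  by rewrite u2E /= in u20 *; lra.
have [lnk3|] := boolP (linked E l (~: flex s) (~: flex d)); last first.
  move=> /(congr1 (fun b : bool => b%:R : R)); rewrite -/(unlinked _ _ _ _) -/u3 => u3E.
  by rewrite u3E /= in u30 *; lra.
have [ls|] := leqP l #|flex s|; last first.
  rewrite -(ltr_nat R) card_flex => ls.
  have : n%:R <= t1 by apply: (@far x); rewrite /V /x; lra.
  by lra.
have [ld|] := leqP l #|flex d|; last first.
  rewrite -(ltr_nat R) card_flex => ld.
  have : n%:R <= t1 by apply: (@far y); rewrite /V /y; lra.
  by lra.
have [ADn|nAD] := leqP (#|flex s| + #|flex d|) n.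
  have := max_matching_linked lnk1 lnk2 lnk3 ls ld ADn.
  by rewrite -(ler_nat R) natrD; lra.
move: nAD; rewrite -(ltr_nat R) natrD !card_flex => nAD.
have xy : n%:R * (1 - B) <= x + y by rewrite /x /y; lra.
have : n%:R <= t2.
  have -> : t2 = 2 * V / ((1 - B) ^+ 2 * n%:R).
    by rewrite /t2; field; rewrite !lt0r_neq0.
  rewrite ler_pdivlMr //.
  have -> : n%:R * ((1 - B) ^+ 2 * n%:R) = (n%:R * (1 - B)) ^+ 2 by ring.
  apply: (@le_trans _ _ ((x + y) ^+ 2)).
    have N1B : 0 <= n%:R * (1 - B) by rewrite mulr_ge0 // ltW.
    by apply: lerXn2r => //; rewrite nnegrE //; apply: le_trans xy.
  by rewrite /V; have := sqr_ge0 (x - y); rewrite !expr2; lra.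
by lra.
Qed.

(** * Expectations *)

Lemma flexP (n : nat) (t : {ffun 'I_n -> 'I_2}) (i : 'I_n) :
  i \in flex t -> t i = flexible.
Proof. by rewrite inE => /eqP. Qed.

(** Averages the pathwise bound over the edges with the types fixed; what remains is quadratic in
    the numbers of flexible nodes. *)
Lemma mean_max_matching_ge_isolated (n : nat) (C : 'M[R]_2)
    (s d : {ffun 'I_n -> 'I_2}) (k h : nat) (B c p i1 i2 : R) :
  (forall x y, 0 <= C x y) -> (0 < n)%N -> 0 < c -> 1 - B = 2 * c ->
  (0 < h)%N -> (n <= k * h)%N ->
  8 ^+ (h * h) <= 1 + C flexible regular -> C flexible regular <= n%:R ->
  8 ^+ (h * h) <= 1 + C regular flexible -> C regular flexible <= n%:R ->
  edge_prob n (C regular regular) = p ->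
  i1 = (4 * (c * n%:R))^-1 -> i2 = (4 * c ^+ 2 * n%:R)^-1 ->
  (n%:R - nflex s) * (n%:R - nflex d) * p - 2 * n%:R ^+ 3 * p ^+ 2
  + (nflex s + nflex d) - i1 * (n%:R ^+ 2 * p + n%:R ^+ 4 * p ^+ 2)
  - (i1 + i2) * (nflex s + nflex d - B * n%:R) ^+ 2
  - k.*2%:R - n%:R * (2^-1 ^+ n + 2^-1 ^+ n)
  <= mean (@edges_pmf n C s d) (fun E => (max_matching E)%:R).
Proof.
move=> C0 n0 c0 Bc h0 nkh hfr cfr hrf crf pE i1E i2E.
have N0 : 0 < n%:R :> R by rewrite ltr0n.
have i10 : 0 <= i1 by rewrite i1E invr_ge0 !mulr_ge0 // ltW.
have w0 := edges_pmf_ge0 s d ^~ C0.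
apply: le_trans (ler_mean w0 (fun E => max_matching_ge_isolated s d E k n0 c0 Bc)).
rewrite -i1E -i2E; set t := (i1 + i2) * _.
rewrite !(meanD, meanN, meanZ) !mean_cst ?edges_pmf_sum1 // mean_nregular_edges pE.
have := mean_nadjacent s d C0; rewrite pE => hP.
have := mean_nregular_edges_sqr s d C0; rewrite pE => hS.
have hU1 : mean (@edges_pmf n C s d) (fun E => unlinked E k (flex s) (~: flex d)) <= 2^-1 ^+ n.
  by apply: (mean_unlinked C0 (x := flexible) (y := regular) _ _ cfr h0 nkh hfr);
    [exact: flexP | exact: not_flex].
have hU2 : mean (@edges_pmf n C s d) (fun E => unlinked E k (~: flex s) (flex d)) <= 2^-1 ^+ n.
  by apply: (mean_unlinked C0 (x := regular) (y := flexible) _ _ crf h0 nkh hrf);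
    [exact: not_flex | exact: flexP].
have hU := ler_wpM2l (ltW N0) (lerD hU1 hU2).
have hS' := ler_wpM2l i10 hS.
apply: lerB => //; rewrite !lerD2r; apply: lerB => //.
by rewrite lerD2r lerD2l lerN2.
Qed.

(** The same averaging, with block sizes [k] for flexible-regular and [l] for regular-regular pairs,
    about n / h and n / g in the application. *)
Lemma mean_max_matching_ge_linked (n : nat) (C : 'M[R]_2)
    (s d : {ffun 'I_n -> 'I_2}) (k l h g : nat) (B : R) :
  (forall x y, 0 <= C x y) -> (0 < n)%N -> 0 < B -> B < 1 ->
  l%:R <= n%:R * B / 4 ->
  (0 < h)%N -> (n <= k * h)%N -> (0 < g)%N -> (n <= l * g)%N ->
  8 ^+ (h * h) <= 1 + C flexible regular -> C flexible regular <= n%:R ->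
  8 ^+ (h * h) <= 1 + C regular flexible -> C regular flexible <= n%:R ->
  8 ^+ (g * g) <= 1 + C regular regular -> C regular regular <= n%:R ->
  n%:R - k.*2%:R - n%:R * (2^-1 ^+ n + 2^-1 ^+ n + 2^-1 ^+ n)
  - (16 / B ^+ 2 + 2 / (1 - B) ^+ 2) / n%:R *
    ((nflex s - n%:R * (B / 2)) ^+ 2 + (nflex d - n%:R * (B / 2)) ^+ 2)
  <= mean (@edges_pmf n C s d) (fun E => (max_matching E)%:R).
Proof.
move=> C0 n0 B0 B1 lB h0 nkh g0 nlg hfr cfr hrf crf hrr crr.
have w0 := edges_pmf_ge0 s d ^~ C0.
apply: le_trans (ler_mean w0 (fun E => max_matching_ge_linked s d E k n0 B0 B1 lB)).
set t := (_ / n%:R * _).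
rewrite !(meanD, meanN, meanZ) !mean_cst ?edges_pmf_sum1 //.
have hU1 : mean (@edges_pmf n C s d) (fun E => unlinked E k (flex s) (~: flex d)) <= 2^-1 ^+ n.
  by apply: (mean_unlinked C0 (x := flexible) (y := regular) _ _ cfr h0 nkh hfr);
    [exact: flexP | exact: not_flex].
have hU2 : mean (@edges_pmf n C s d) (fun E => unlinked E k (~: flex s) (flex d)) <= 2^-1 ^+ n.
  by apply: (mean_unlinked C0 (x := regular) (y := flexible) _ _ crf h0 nkh hrf);
    [exact: not_flex | exact: flexP].
have hU3 : mean (@edges_pmf n C s d) (fun E => unlinked E l (~: flex s) (~: flex d)) <= 2^-1 ^+ n.
  by apply: (mean_unlinked C0 (x := regular) (y := regular) _ _ crr g0 nlg hrr);
    exact: not_flex.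
have hU := ler_wpM2l (ler0n _ n) (lerD (lerD hU1 hU2) hU3).
by rewrite lerD2r lerD2l lerN2.
Qed.

(** The common shape of both lower bounds. Supply and demand types are independent, so the mean of
    the product term factors. *)
Lemma mean2_quadratic (n : nat) (b u v w x : R) :
  mean (@types_pmf n b) (fun s => mean (@types_pmf n b) (fun d =>
    u * ((n%:R - nflex s) * (n%:R - nflex d)) + v * (nflex s + nflex d) + w
    + x * ((nflex s - n%:R * b) ^+ 2 + (nflex d - n%:R * b) ^+ 2))) =
  u * (n%:R - n%:R * b) ^+ 2 + v * (2 * n%:R * b) + w
  + x * (2 * mean (@types_pmf n b) (fun t => (nflex t - n%:R * b) ^+ 2)).
Proof.
have w1 := types_pmf_sum1 n b.
under eq_mean => s.
  rewrite !(meanD, meanZ) !mean_cst // meanN mean_nflex.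
  over.
rewrite !(meanD, meanZ, meanZr) !mean_cst // meanN mean_nflex.
by ring.
Qed.

Lemma mulr_half_exp_le1 (n : nat) : n%:R * 2^-1 ^+ n <= 1 :> R.
Proof.
rewrite exprVn ler_pdivrMr ?exprn_gt0 // mul1r -natrX ler_nat.
exact/ltnW/ltn_expl.
Qed.

Lemma conn_mx_ge0 (a f : R) (x y : 'I_2) : 0 <= a -> 0 <= f -> 0 <= conn_mx a f x y.
Proof.
by move=> a0 f0; rewrite mxE; do ![case: ifP => _]; rewrite ?addr_ge0 ?mulr_ge0.
Qed.

(* (n %/ h).+1 is the block size of the union bound. *)
Lemma double_divn_succ_le (n h : nat) :
  (0 < h)%N -> (n %/ h).+1.*2%:R <= n%:R * (2 / h%:R) + 2 :> R.
Proof.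
move=> h0; have H0 : 0 < h%:R :> R by rewrite ltr0n.
rewrite -muln2 natrM -natr1 mulrDl mul1r lerD2r mulrA ler_pdivlMr // mulrAC.
by rewrite ler_wpM2r // -natrM ler_nat leq_trunc_div.
Qed.

Lemma leq_divn_succ_mul (n h : nat) : (0 < h)%N -> (n <= (n %/ h).+1 * h)%N.
Proof. by move=> h0; rewrite ltnW // -ltn_divLR. Qed.

(** Per node: B from the flexible nodes and 2 a (1 - B/2)^2 from the regular edges; 8 a^2 is lost to
    adjacent edges, a^2 / c to the truncation at n, and 2 / h to the unmatched blocks. The
    subtracted constant collects the terms bounded in n: diagonal second moment, variances, rounding
    of [k], and link failures. *)
Lemma two_sided_ge_low (B a f c : R) (n h : nat) :
  0 < B -> B < 1 -> 0 <= a -> 0 <= f -> 1 - B = 2 * c -> (0 < h)%N ->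
  8 ^+ (h * h) <= 1 + (a + f) -> (0 < n)%N -> 2 * a <= n%:R -> a + f <= n%:R ->
  n%:R * (B + 2 * a * (1 - B / 2) ^+ 2 - 8 * a ^+ 2 - a ^+ 2 / c - 2 / h%:R)
  - (a / (2 * c) + c^-1 + (c ^+ 2)^-1 + 4)
  <= expected_max_matching n (B / 2) (B / 2) (conn_mx a f).
Proof.
move=> B0 B1 a0 f0 Bc h0 hf n0 an afn.
have N0 : 0 < n%:R :> R by rewrite ltr0n.
have c0 : 0 < c by lra.
have C0 x y := conn_mx_ge0 x y a0 f0.
have b01 : 0 <= B / 2 <= 1 by apply/andP; split; lra.
have w0 t : 0 <= @types_pmf n (B / 2) t by apply: types_pmf_ge0.
set k := (n %/ h).+1.
have pE : edge_prob n (conn_mx a f regular regular) = 2 * a / n%:R.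
  by rewrite mxE /= edge_probE // mulr_ge0.
pose i1 := (4 * (c * n%:R))^-1; pose i2 := (4 * c ^+ 2 * n%:R)^-1.
have i0 : 0 <= i1 + i2.
  by rewrite addr_ge0 // invr_ge0 !mulr_ge0 ?exprn_ge0 // ltW.
pose p := 2 * a / n%:R.
pose w := - (2 * n%:R ^+ 3 * p ^+ 2) - i1 * (n%:R ^+ 2 * p + n%:R ^+ 4 * p ^+ 2)
  - k.*2%:R - n%:R * (2^-1 ^+ n + 2^-1 ^+ n).
pose G (s d : {ffun 'I_n -> 'I_2}) : R :=
  p * ((n%:R - nflex s) * (n%:R - nflex d)) + 1 * (nflex s + nflex d) + w
  + - (2 * (i1 + i2)) * ((nflex s - n%:R * (B / 2)) ^+ 2 +
                         (nflex d - n%:R * (B / 2)) ^+ 2).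
have fr : conn_mx a f flexible regular = a + f by rewrite mxE.
have rf : conn_mx a f regular flexible = a + f by rewrite mxE.
rewrite expected_max_matchingE.
apply: (@le_trans _ _ (mean (types_pmf (B / 2)) (fun s => mean (types_pmf (B / 2)) (G s)))).
  rewrite mean2_quadratic.
  have := ler_wpM2l i0 (var_nflex n b01); set v := mean _ _ => hv.
  have hk := double_divn_succ_le n h0; rewrite -/k in hk.
  have hU := mulr_half_exp_le1 n.
  have e1 : p * (n%:R - n%:R * (B / 2)) ^+ 2 = n%:R * (2 * a * (1 - B / 2) ^+ 2).
    by rewrite /p; field; rewrite lt0r_neq0.
  have e2 : 2 * n%:R ^+ 3 * p ^+ 2 = n%:R * (8 * a ^+ 2).
    by rewrite /p; field; rewrite lt0r_neq0.
  have e3 : i1 * (n%:R ^+ 2 * p + n%:R ^+ 4 * p ^+ 2) = a / (2 * c) + n%:R * (a ^+ 2 / c).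
    by rewrite /p /i1; field; rewrite !lt0r_neq0.
  have e4 : (i1 + i2) * n%:R = (c^-1 + (c ^+ 2)^-1) / 4.
    by rewrite /i1 /i2; field; rewrite !lt0r_neq0.
  rewrite e1 /w e2 e3; rewrite e4 in hv.
  by rewrite !mulrDr !mulrN; move: hv hk hU; rewrite !mulrDl; lra.
apply: ler_mean => // s; apply: ler_mean => // d.
apply: le_trans (mean_max_matching_ge_isolated s d C0 n0 c0 Bc h0
  (leq_divn_succ_mul n h0) _ _ _ _ pE erefl erefl); rewrite ?fr ?rf //.
rewrite -/i1 -/i2 -/k -/p /G /w.
set x := nflex s; set y := nflex d.
(* Bounds the squared total deviation by twice the sum of the squared deviations of the two
   sides. *)
have : (i1 + i2) * (x + y - B * n%:R) ^+ 2 <= (i1 + i2) *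
    (2 * ((x - n%:R * (B / 2)) ^+ 2 + (y - n%:R * (B / 2)) ^+ 2)).
  rewrite ler_wpM2l //; have := sqr_ge0 (x - y); rewrite !expr2; lra.
by lra.
Qed.

(** The linear loss 2 / h comes from the two stages of flexible-regular extension; the variances, of
    order n, are divided by n and stay bounded. *)
Lemma two_sided_ge_high (B a f : R) (n h g : nat) :
  0 < B -> B < 1 -> 0 <= a -> 0 <= f -> (0 < h)%N -> (0 < g)%N ->
  8 ^+ (h * h) <= 1 + (a + f) -> 8 ^+ (g * g) <= 1 + 2 * a ->
  8 <= g%:R * B -> 8 <= n%:R * B ->
  (0 < n)%N -> 2 * a <= n%:R -> a + f <= n%:R ->
  n%:R * (1 - 2 / h%:R) - (5 + 32 / B ^+ 2 + 4 / (1 - B) ^+ 2)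
  <= expected_max_matching n (B / 2) (B / 2) (conn_mx a f).
Proof.
move=> B0 B1 a0 f0 h0 g0 hf ga gB nB n0 an afn.
have N0 : 0 < n%:R :> R by rewrite ltr0n.
have G0 : 0 < g%:R :> R by rewrite ltr0n.
have C0 x y := conn_mx_ge0 x y a0 f0.
have b01 : 0 <= B / 2 <= 1 by apply/andP; split; lra.
have w0 t : 0 <= @types_pmf n (B / 2) t by apply: types_pmf_ge0.
set k := (n %/ h).+1; pose l := (n %/ g).+1.
(* Both n / g and the rounding term 1 are at most n B / 8. *)
have lB : l%:R <= n%:R * B / 4.
  rewrite /l -natr1; have : (n %/ g)%:R * g%:R <= n%:R :> R.
    by rewrite -natrM ler_nat leq_trunc_div.
  move=> q; have : (n %/ g)%:R * 8 <= n%:R * B.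
    have q0 : 0 <= (n %/ g)%:R :> R by rewrite ler0n.
    apply: le_trans (ler_wpM2l q0 gB) _; rewrite mulrA.
    by rewrite ler_wpM2r // ltW.
  lra.
pose m := (16 / B ^+ 2 + 2 / (1 - B) ^+ 2) / n%:R.
have B'0 : 0 < 1 - B by rewrite subr_gt0.
have m0 : 0 <= m by rewrite mulr_ge0 ?invr_ge0 // addr_ge0 // mulr_ge0 // invr_ge0 exprn_ge0 // ltW.
(* The zero coefficients put the bound in the shape of [mean2_quadratic]. *)
pose G (s d : {ffun 'I_n -> 'I_2}) : R :=
  0 * ((n%:R - nflex s) * (n%:R - nflex d)) + 0 * (nflex s + nflex d)
  + (n%:R - k.*2%:R - n%:R * (2^-1 ^+ n + 2^-1 ^+ n + 2^-1 ^+ n))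
  + - m * ((nflex s - n%:R * (B / 2)) ^+ 2 + (nflex d - n%:R * (B / 2)) ^+ 2).
have fr : conn_mx a f flexible regular = a + f by rewrite mxE.
have rf : conn_mx a f regular flexible = a + f by rewrite mxE.
have rr : conn_mx a f regular regular = 2 * a by rewrite mxE.
rewrite expected_max_matchingE.
apply: (@le_trans _ _ (mean (types_pmf (B / 2)) (fun s => mean (types_pmf (B / 2)) (G s)))).
  rewrite mean2_quadratic.
  have := ler_wpM2l m0 (var_nflex n b01); set v := mean _ _ => hv.
  have hk := double_divn_succ_le n h0; rewrite -/k in hk.
  have hU := mulr_half_exp_le1 n.
  have e4 : m * n%:R = 16 / B ^+ 2 + 2 / (1 - B) ^+ 2 by rewrite divfK ?lt0r_neq0.
  rewrite e4 in hv; move: hv hk hU; clear; lra.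
apply: ler_mean => // s; apply: ler_mean => // d.
apply: le_trans (mean_max_matching_ge_linked s d C0 n0 B0 B1 lB h0
  (leq_divn_succ_mul n h0) g0 (leq_divn_succ_mul n g0) _ _ _ _ _ _);
  rewrite ?fr ?rf ?rr //.
by rewrite /G !mul0r !add0r mulNr.
Qed.

(** All demand nodes are regular, so a regular supply node has expected degree n p <= 2 a; the
    flexible supply nodes serve as the cover. *)
Lemma one_sided_le_low (B a f : R) (n : nat) :
  0 <= B <= 1 -> 0 <= a -> 0 <= f ->
  expected_max_matching n B 0 (conn_mx a f) <= n%:R * (B + 2 * a * (1 - B)).
Proof.
move=> B01 a0 f0; have C0 x y := conn_mx_ge0 x y a0 f0.
rewrite expected_max_matchingE.
have w0 t : 0 <= @types_pmf n B t by apply: types_pmf_ge0.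
set p := edge_prob n (conn_mx a f regular regular).
have pn : n%:R * p <= 2 * a.
  rewrite /p mxE /= /edge_prob; case: n {w0 p} => [|n]; first by rewrite mul0r mulr_ge0.
  by rewrite mulrC -ler_pdivlMr ?ltr0n // ge_min lexx orbT.
set d0 : {ffun 'I_n -> 'I_2} := [ffun=> regular].
have nd0 : nflex d0 = 0 by rewrite /nflex big1 // => i _; rewrite ffunE.
apply: (@le_trans _ _ (mean (@types_pmf n B)
  (fun s => nflex s + n%:R * p * (n%:R - nflex s)))).
  apply: ler_mean => // s; rewrite mean_types_prob0 -/d0.
  have := mean_nregular_edges (conn_mx a f) s d0; rewrite nd0 subr0 -/p => Er.
  rewrite -[X in X + _](mean_cst (nflex s) (edges_pmf_sum1 (conn_mx a f) s d0)).
  rewrite [leRHS](_ : _ = mean (edges_pmf (conn_mx a f) s d0)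
    (fun E => nflex s + nregular_edges s d0 E)); last first.
    by rewrite meanD Er; congr (_ + _); ring.
  apply: ler_mean => E; first exact: edges_pmf_ge0.
  rewrite -card_flex regular_edges_card -natrD ler_nat.
  apply: leq_trans (max_matching_le_cover E (flex s)) _.
  rewrite leq_add2l subset_leq_card //; apply/subsetP => -[i j].
  by rewrite !(inE, in_setX) ffunE andbT andbC.
rewrite meanD meanZ meanD meanN mean_cst ?types_pmf_sum1 // mean_nflex.
have -> : n%:R * (B + 2 * a * (1 - B)) = n%:R * B + 2 * a * (n%:R - n%:R * B) by ring.
rewrite lerD2l ler_wpM2r //; case/andP: B01 => _ B1.
by rewrite subr_ge0 ler_piMr.
Qed.

(** Facing only regular demand nodes, a regular supply node is isolated with probability (1 - p)^n,
    and isolated nodes stay unmatched. *)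
Lemma one_sided_le_high (B a f : R) (n : nat) :
  0 <= B <= 1 -> 0 <= a -> 0 <= f ->
  expected_max_matching n B 0 (conn_mx a f) <=
  n%:R * (1 - (1 - B) * (1 - edge_prob n (2 * a)) ^+ n).
Proof.
move=> B01 a0 f0; have C0 x y := conn_mx_ge0 x y a0 f0.
rewrite expected_max_matchingE.
have w0 t : 0 <= @types_pmf n B t by apply: types_pmf_ge0.
have rr : conn_mx a f regular regular = 2 * a by rewrite mxE.
set q := (1 - edge_prob n (2 * a)) ^+ n.
set d0 : {ffun 'I_n -> 'I_2} := [ffun=> regular].
apply: (@le_trans _ _ (mean (@types_pmf n B) (fun s => n%:R - q * (n%:R - nflex s)))).
  apply: ler_mean => // s; rewrite mean_types_prob0 -/d0.
  have noE i : i \in ~: flex s ->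
      mean (edges_pmf (conn_mx a f) s d0) (fun E => (no_edge E i)%:R) = q.
    move=> /not_flex si; rewrite mean_edges_avoid (eq_bigr (fun=> 1 - edge_prob n (2 * a))).
      by rewrite prodr_const cardsX cards1 cardsT card_ord mul1n.
    move=> [i' j]; rewrite in_setX inE => /andP[/eqP -> _].
    by rewrite /edge_pr /= si ffunE rr.
  rewrite [leRHS](_ : _ = mean (edges_pmf (conn_mx a f) s d0)
    (fun E => n%:R + - \sum_(i in ~: flex s) (no_edge E i)%:R)); last first.
    rewrite meanD meanN mean_sum mean_cst ?edges_pmf_sum1 // (eq_bigr (fun=> q)) //.
    by rewrite sumr_const -card_regular mulr_natr.
  apply: ler_mean => E; first exact: edges_pmf_ge0.
  have := @max_matching_isolated n E [set i in ~: flex s | no_edge E i].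
  rewrite -(ler_nat R) natrD lerBrDr.
  have -> : [set i in ~: flex s | no_edge E i] = ~: flex s :&: [set i | no_edge E i].
    by apply/setP => i; rewrite !inE.
  rewrite natr_cardI; under eq_bigr do rewrite inE.
  by apply=> i; rewrite !inE => /andP[].
rewrite meanD meanN meanZ meanD meanN !mean_cst ?types_pmf_sum1 // mean_nflex.
rewrite le_eqVlt; apply/orP; left; apply/eqP; ring.
Qed.

Lemma bernoulli_ineq_sub (y : R) (n : nat) :
  0 <= y <= 1 -> 1 - n%:R * y <= (1 - y) ^+ n.
Proof.
move=> /andP[y0 y1]; elim: n => [|n IH]; first by rewrite mul0r subr0 expr0.
rewrite exprS; apply: le_trans (ler_wpM2l _ IH); last by rewrite subr_ge0.
have : 0 <= n%:R * y * y by rewrite !mulr_ge0.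
by rewrite -natr1; lra.
Qed.

(** Cover the exponent [n] by m > 2 x blocks of length j + 1, where j = n %/ m. With y = x / n, j y
    <= 1/2 and y <= 1/4, so Bernoulli bounds each block below by 1/4. *)
Lemma isolation_probability_ge (x : R) :
  0 <= x -> exists2 q : R, 0 < q & exists N : nat, forall n : nat, (N <= n)%N ->
    q <= (1 - edge_prob n x) ^+ n.
Proof.
move=> x0; have xm := archi_boundP (_ : 0 <= 2 * x).
set m := (Num.Def.archi_bound (2 * x)) in xm.
have {}xm : 2 * x < m%:R by apply: xm; rewrite mulr_ge0.
have m0 : (0 < m)%N by rewrite -(ltr_nat R); lra.
have M0 : 0 < m%:R :> R by rewrite ltr0n.
exists (4^-1 ^+ m); first by rewrite exprn_gt0 // invr_gt0.
exists (2 * m)%N => n mn.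
have n0 : (0 < n)%N by rewrite (leq_trans _ mn) // muln_gt0.
have N0 : 0 < n%:R :> R by rewrite ltr0n.
have nx : 4 * x <= n%:R by move: mn; rewrite -(ler_nat R) natrM; lra.
have xn : x <= n%:R by lra.
rewrite edge_probE ?x0 //; set y := x / n%:R.
have y01 : 0 <= y <= 1 by rewrite divr_ge0 //= ler_pdivrMr // mul1r.
have /andP[y0 y1] := y01.
apply: (@le_trans _ _ ((1 - y) ^+ ((n %/ m).+1 * m))); last first.
  by apply: ler_wiXn2l; rewrite ?subr_ge0 ?gerBl ?leq_divn_succ_mul.
rewrite exprM; apply: lerXn2r; rewrite ?nnegrE ?invr_ge0 ?exprn_ge0 ?subr_ge0 //.
apply: le_trans (bernoulli_ineq_sub _ y01).
have yn : y * n%:R = x by rewrite /y divfK ?lt0r_neq0.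
have : (n %/ m)%:R * m%:R <= n%:R :> R by rewrite -natrM ler_nat leq_trunc_div.
set j : R := (n %/ m)%:R => jm.
have j0 : 0 <= j by rewrite ler0n.
have h1 : j * y <= 2^-1.
  have : y * (j * m%:R) <= x by rewrite -yn ler_wpM2l.
  by move=> h; rewrite -(ler_pM2r M0); lra.
have h2 : y <= 4^-1 by rewrite ler_pdivrMr // mulrC; lra.
have -> : (n %/ m).+1%:R = j + 1 by rewrite /j natr1.
by lra.
Qed.

(** * Limits *)

(** [Lim_seq] respects eventual inequalities, and the two finite bounds exclude the infinite values,
    which [Rbar.real] sends to 0. *)
Lemma Lim_seq_itv (u : nat -> R) (a b : R) (N : nat) :
  (forall n, (N <= n)%N -> a <= u n <= b) ->
  a <= Rbar.real (Lim_seq.Lim_seq u) <= b.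
Proof.
move=> uab.
have la : Rbar.Rbar_le (Rbar.Finite a) (Lim_seq.Lim_seq u).
  rewrite -Lim_seq.Lim_seq_const; apply: Lim_seq.Lim_seq_le_loc; exists N => n /ssrnat.leP Nn.
  by apply/RleP; case/andP: (uab n Nn).
have lb : Rbar.Rbar_le (Lim_seq.Lim_seq u) (Rbar.Finite b).
  rewrite -Lim_seq.Lim_seq_const; apply: Lim_seq.Lim_seq_le_loc; exists N => n /ssrnat.leP Nn.
  by apply/RleP; case/andP: (uab n Nn).
by case: (Lim_seq.Lim_seq u) la lb => //= r /RleP -> /RleP ->.
Qed.

Lemma expected_max_matching_itv (n : nat) (bL bR : R) (C : 'M[R]_2) :
  0 <= bL <= 1 -> 0 <= bR <= 1 -> (forall x y, 0 <= C x y) ->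
  0 <= expected_max_matching n bL bR C <= n%:R.
Proof.
move=> bL01 bR01 C0; rewrite expected_max_matchingE.
have wL t : 0 <= @types_pmf n bL t by apply: types_pmf_ge0.
have wR t : 0 <= @types_pmf n bR t by apply: types_pmf_ge0.
apply/andP; split.
  apply: mean_ge0 => // s; apply: mean_ge0 => // d.
  by apply: mean_ge0 => // E; apply: edges_pmf_ge0.
rewrite -[leRHS](mean_cst _ (types_pmf_sum1 n bL)); apply: ler_mean => // s.
rewrite -[leRHS](mean_cst _ (types_pmf_sum1 n bR)); apply: ler_mean => // d.
rewrite -[leRHS](mean_cst _ (edges_pmf_sum1 C s d)); apply: ler_mean => E.
  exact: edges_pmf_ge0.
by rewrite ler_nat max_matching_le.
Qed.

Lemma eta_le (bL bR c : R) (C : 'M[R]_2) (N : nat) :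
  0 <= bL <= 1 -> 0 <= bR <= 1 -> (forall x y, 0 <= C x y) ->
  (forall n, (N <= n)%N -> expected_max_matching n bL bR C <= n%:R * c) ->
  eta bL bR C <= c.
Proof.
move=> bL01 bR01 C0 hc.
suff /andP[] : 0 <= eta bL bR C <= c by [].
(* The successor excludes n = 0, where the quotient would be a division by 0. *)
apply: (@Lim_seq_itv _ _ _ N.+1) => n Nn; have n0 : (0 < n)%N by apply: leq_trans Nn.
have /andP[e0 _] := expected_max_matching_itv n bL01 bR01 C0.
by rewrite divr_ge0 //= ler_pdivrMr ?ltr0n // mulrC hc // ltnW.
Qed.

(** The slack V - c absorbs the additive constant once n > K / (V - c). *)
Lemma eta_ge (bL bR c V K : R) (C : 'M[R]_2) (N : nat) :
  0 <= bL <= 1 -> 0 <= bR <= 1 -> (forall x y, 0 <= C x y) -> c < V -> 0 <= K ->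
  (forall n, (N <= n)%N -> n%:R * V - K <= expected_max_matching n bL bR C) ->
  c <= eta bL bR C.
Proof.
move=> bL01 bR01 C0 cV K0 hV.
suff /andP[] : c <= eta bL bR C <= 1 by [].
have VC : 0 < V - c by rewrite subr_gt0.
have /archi_boundP := divr_ge0 K0 (ltW VC); set m := Num.Def.archi_bound _ => hm.
apply: (@Lim_seq_itv _ _ _ (N + m).+1) => n Nn.
have n0 : (0 < n)%N by apply: leq_trans Nn.
have N0 : 0 < n%:R :> R by rewrite ltr0n.
have /andP[_ e1] := expected_max_matching_itv n bL01 bR01 C0.
rewrite ler_pdivlMr // ler_pdivrMr // mul1r e1 andbT.
have Nn' : (N <= n)%N by apply: leq_trans (ltnW Nn); apply: leq_addr.
have mn : m%:R <= n%:R :> R.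
  by rewrite ler_nat; apply: leq_trans (ltnW Nn); apply: leq_addl.
apply: le_trans (hV n Nn'); move: hm; rewrite ltr_pdivrMr // => hm.
have : m%:R * (V - c) <= n%:R * (V - c) by rewrite ler_wpM2r // ltW.
by lra.
Qed.

(** In [eta_TS] the halves are parsed with the Stdlib division and an integer literal; here they
    become ring operations. *)
Lemma eta_TSE (B a f : R) :
  eta_TS B a f = eta (B / 2) (B / 2) (conn_mx a f).
Proof. by rewrite /eta_TS RdivE IZRposE INRE. Qed.

(** * Comparison of the two allocations in both regimes *)

Theorem theorem5 (B : R) (hB0 : 0 < B) (hB1 : B < 1) :
  (exists alpha_low : R, 0 < alpha_low /\
     forall alpha : R, 0 < alpha -> alpha < alpha_low ->
       exists alphaf_bar : R, 0 < alphaf_bar /\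
         forall alphaf : R, alphaf_bar < alphaf ->
           eta_OS B alpha alphaf < eta_TS B alpha alphaf)
  /\
  (exists alpha_high : R, 0 < alpha_high /\
     forall alpha : R, alpha_high < alpha ->
       exists alphaf_bar : R, 0 < alphaf_bar /\
         forall alphaf : R, alphaf_bar < alphaf ->
           eta_OS B alpha alphaf < eta_TS B alpha alphaf).
Proof.
have B01 : 0 <= B <= 1 by rewrite !ltW.
have b01 : 0 <= B / 2 <= 1 by apply/andP; split; lra.
have z01 : 0 <= (0 : R) <= 1 by rewrite lexx ler01.
have inv_small (e : R) : 0 < e -> exists2 h : nat, (0 < h)%N & 2 / h%:R < e.
  move=> e0; have /archi_boundP : 0 <= 2 / e by rewrite divr_ge0 // ltW.
  set h := Num.Def.archi_bound _ => he.
  have h0 : 0 < h%:R :> R by apply: le_lt_trans he; rewrite divr_ge0 // ltW.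
  exists h; first by rewrite -(ltr_nat R).
  by rewrite ltr_pdivrMr // mulrC -ltr_pdivrMr.
have large (x y : R) : exists N : nat, forall n : nat, (N <= n)%N ->
    [/\ (0 < n)%N, x <= n%:R & y <= n%:R].
  exists (Num.Def.archi_bound `|x| + Num.Def.archi_bound `|y|).+1 => n Nn.
  have le_bound (z : R) : z <= (Num.Def.archi_bound `|z|)%:R.
    by apply: le_trans (ler_norm z) _; rewrite ltW // archi_boundP.
  split; first exact: leq_trans Nn.
    apply: le_trans (le_bound x) _; rewrite ler_nat.
    by apply: leq_trans (ltnW Nn); apply: leq_addr.
  apply: le_trans (le_bound y) _; rewrite ler_nat.
  by apply: leq_trans (ltnW Nn); apply: leq_addl.
split.
  have [c Bc] : exists c : R, 1 - B = 2 * c by exists ((1 - B) / 2); field.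
  have c0 : 0 < c by lra.
  (* [D] is the coefficient of the losses quadratic in [a]. The two-sided gain is 2 a ((1 - B/2)^2 -
     (1 - B)) = a B^2 / 2; the threshold keeps D a^2 below a B^2 / 4 and [h] keeps 2 / h below a B^2
     / 8. *)
  pose D := 8 + c^-1; have D0 : 0 < D by rewrite addr_gt0 ?invr_gt0.
  exists (B ^+ 2 / (4 * D)); split; first by rewrite divr_gt0 ?exprn_gt0 ?mulr_gt0.
  move=> a a0; rewrite ltr_pdivlMr ?mulr_gt0 // => aD.
  have aB : 0 < a * B ^+ 2 by rewrite mulr_gt0 ?exprn_gt0.
  have [h h0 he] := inv_small (a * B ^+ 2 / 8) (divr_gt0 aB (ltr0Sn _ _)).
  exists (8 ^+ (h * h)); split; first by rewrite exprn_gt0.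
  move=> f hf; have f0 : 0 <= f by apply: ltW; apply: lt_trans hf; rewrite exprn_gt0.
  have C0 x y := conn_mx_ge0 x y (ltW a0) f0.
  have [N hN] := large (2 * a) (a + f).
  have hOS : eta_OS B a f <= B + 2 * a * (1 - B).
    by apply: (@eta_le _ _ _ _ 0) => // n _; apply: one_sided_le_low => //; apply: ltW.
  pose V := B + 2 * a * (1 - B / 2) ^+ 2 - 8 * a ^+ 2 - a ^+ 2 / c - 2 / h%:R.
  have hV : B + 2 * a * (1 - B) < V.
    have : a * (a * (4 * D)) < a * B ^+ 2 by rewrite ltr_pM2l.
    by rewrite /V /D; lra.
  rewrite eta_TSE; apply: le_lt_trans hOS _.
  (* The midpoint lies strictly below [V], as [eta_ge] requires. *)
  apply: (@lt_le_trans _ _ ((B + 2 * a * (1 - B) + V) / 2)); first by lra.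
  pose K := a / (2 * c) + c^-1 + (c ^+ 2)^-1 + 4.
  apply: (@eta_ge _ _ _ V K _ N) => //.
  - by lra.
  - by rewrite !addr_ge0 ?divr_ge0 ?invr_ge0 ?exprn_ge0 ?mulr_ge0 ?(ltW a0) ?(ltW c0).
  move=> n /hN[n0 an afn]; apply: two_sided_ge_low => //; first exact: ltW.
  by lra.
(* Makes g B >= 8, so that the regular-regular block size is at most n B / 4; alpha > 8^(g^2) then
   links the regular nodes at that size. *)
have [g g0 gB] := inv_small (B / 4) (divr_gt0 hB0 (ltr0Sn _ _)).
have G0 : 0 < g%:R :> R by rewrite ltr0n.
have {}gB : 8 <= g%:R * B by move: gB; rewrite ltr_pdivrMr //; lra.
exists (8 ^+ (g * g)); split; first by rewrite exprn_gt0.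
move=> a ga; have a0 : 0 < a by apply: lt_trans ga; rewrite exprn_gt0.
have [q q0 [M hM]] := isolation_probability_ge (mulr_ge0 (ler0n _ 2) (ltW a0)).
(* [e] bounds from below the fraction of isolated regular supply nodes in the one-sided graph; [h]
   is chosen so that the two-sided loss 2 / h is below half of it. *)
pose e := (1 - B) * q; have e0 : 0 < e by rewrite mulr_gt0 // subr_gt0.
have [h h0 he] := inv_small (e / 2) (divr_gt0 e0 (ltr0Sn _ _)).
exists (8 ^+ (h * h)); split; first by rewrite exprn_gt0.
move=> f hf; have f0 : 0 <= f by apply: ltW; apply: lt_trans hf; rewrite exprn_gt0.
have C0 x y := conn_mx_ge0 x y (ltW a0) f0.
have hOS : eta_OS B a f <= 1 - e.
  apply: (@eta_le _ _ _ _ M) => // n /hM hq.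
  apply: le_trans (one_sided_le_high n B01 (ltW a0) f0) _.
  by rewrite ler_wpM2l // lerD2l lerN2 ler_wpM2l // subr_ge0 ltW.
rewrite eta_TSE; apply: le_lt_trans hOS _.
(* [N'] ensures n B >= 8; its second bound 0 is a placeholder. *)
have [N hN] := large (2 * a) (a + f); have [N' hN'] := large (8 / B) 0.
apply: (@lt_le_trans _ _ (1 - e / 2)); first by lra.
pose V := 1 - (2%:R : R) / h%:R; pose K := 5 + 32 / B ^+ 2 + 4 / (1 - B) ^+ 2.
apply: (@eta_ge _ _ _ V K _ (N + N')) => //.
- by rewrite /V ltrD2l ltrN2.
- by rewrite !addr_ge0 // divr_ge0 // sqr_ge0.
move=> n Nn.
have /hN[n0 an afn] : (N <= n)%N by apply: leq_trans Nn; apply: leq_addr.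
have /hN'[_ nB _] : (N' <= n)%N by apply: leq_trans Nn; apply: leq_addl.
rewrite ler_pdivrMr // in nB.
by apply: (@two_sided_ge_high _ _ _ _ _ g) => //; lra.
Qed.
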